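(* For all integers $d,k\ge 2$, the Neretin group $\mathcal N_{d,k}$ does not have any confined relatively amenable (closed) subgroup. In particular $\mathcal N_{d,k}$ does not have any cocompact amenable (closed) subgroup.
   Context: Neretin groups. Let $d,k\ge 2$ be integers and let $\mathcal T_{d,k}$ be the rooted tree in which the root has $k$ descendants and every other vertex has $d$ descendants. An almost automorphism of $\mathcal T_{d,k}$ is a triple $(A,B,\varphi)$ where $A,B$ are finite subtrees of $\mathcal T_{d,k}$ containing the root with $|\partial A|=|\partial B|$ (here $\partial A$ may be taken to be the set of vertices outside $A$ adjacent to $A$, i.e. the complements $\mathcal T_{d,k}\setminus A$ and $\mathcal T_{d,k}\setminus B$ have the same number of connected components) and $\varphi:\mathcal T_{d,k}\setminus A\to\mathcal T_{d,k}\setminus B$ is an isomorphism of forests. Two triples $(A,B,\varphi)$, $(A',B',\varphi')$ are identified if there is a finite subtree $A''\supseteq A\cup A'$ such that $\varphi$ and $\varphi'$ coincide on $\mathcal T_{d,k}\setminus A''$. The set of equivalence classes is a group $\mathcal N_{d,k}$ under composition, the Neretin group; it acts faithfully by homeomorphisms on the space of ends $\partial\mathcal T_{d,k}$. It carries a unique locally compact group topology for which the inclusion of the profinite group $\mathrm{Aut}(\mathcal T_{d,k})$ (automorphisms of the rooted tree) is continuous and open; it is always endowed with this topology. For a locally compact group $G$, $\mathrm{Sub}(G)$ denotes the compact Chabauty space of closed subgroups of $G$. A closed subgroup $H\le G$ is confined in $G$ if the closure in $\mathrm{Sub}(G)$ of the conjugacy class of $H$ does not contain the trivial subgroup. A closed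 subgroup $H\le G$ is relatively amenable in $G$ if $H$ fixes a Borel probability measure on every compact $G$-space (compact space with a continuous $G$-action). $H$ is cocompact in $G$ if $G/H$ is compact. *)

(* Defs.v *)
From HB Require Import structures.
From mathcomp Require Import all_boot all_classical all_reals.
From mathcomp Require Import topology measure.

Set Implicit Arguments.
Unset Strict Implicit.
Unset Printing Implicit Defensive.

Local Open Scope classical_set_scope.
Local Open Scope card_scope.
Local Open Scope quotient_scope.
Local Open Scope group_scope.

(* As usual for locally compact groups, topological groups are Hausdorff; for a
   topological group this amounts to {1} being closed. *)
HB.mixin Record isTopologicalGroup G & Group G & Topological G := {
  mulg_continuous : continuous (fun x : G * G => x.1 * x.2);
  invg_continuous : continuous (fun x : G => x^-1);
  one_closed : closed [set (1 : G)];
}.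

#[short(type="topologicalGroupType")]
HB.structure Definition TopologicalGroup :=
  {G of Group G & Topological G & isTopologicalGroup G}.

Section ClosedSubgroups.
Variable G : topologicalGroupType.

Record closedSubgroup := ClosedSubgroup {
  subgroup_set :> set G;
  closedSubgroup_group : group_closed (mem subgroup_set);
  closedSubgroup_closed : closed subgroup_set }.

HB.instance Definition _ := gen_eqMixin closedSubgroup.
HB.instance Definition _ := gen_choiceMixin closedSubgroup.

Definition chabauty_subbase : set (set closedSubgroup) :=
  [set [set H : closedSubgroup | H `&` K = set0] | K in (@compact G)] `|`
  [set [set H : closedSubgroup | H `&` U !=set0] | U in (@open G)].

(* closedSubgroup G, with the Chabauty topology, is Sub(G). *)
HB.instance Definition _ := @isSubBaseTopological.Build closedSubgroup
  (set closedSubgroup) chabauty_subbase id.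

Lemma trivial_group_closed : group_closed (mem [set (1 : G)]).
Proof.
split; first by rewrite in_setE.
move=> x y; rewrite !in_setE => -> ->; exact: divgg.
Qed.

Definition trivial_subgroup := ClosedSubgroup trivial_group_closed one_closed.

Definition conjugacy_class (H : closedSubgroup) : set closedSubgroup :=
  [set K | exists g : G, K = [set x ^ g | x in H] :> set G].

Definition confined (H : closedSubgroup) : Prop :=
  ~ closure (conjugacy_class H) trivial_subgroup.

Definition lcoset_rel (H : closedSubgroup) : rel G :=
  fun x y => x^-1 * y \in (H : set G).

Section Lcosets.
Variable H : closedSubgroup.

Lemma lcoset_rel_refl : reflexive (lcoset_rel H).
Proof. by move=> x; rewrite /lcoset_rel mulVg; case: (closedSubgroup_group H). Qed.

Lemma lcoset_rel_sym : symmetric (lcoset_rel H).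
Proof.
suff sub x y : lcoset_rel H x y -> lcoset_rel H y x.
  by move=> x y; apply/idP/idP; exact: sub.
move=> /(group_closedV (closedSubgroup_group H)).
by rewrite invgM invgK.
Qed.

Lemma lcoset_rel_trans : transitive (lcoset_rel H).
Proof.
move=> y x z xy yz.
have := group_closedM (closedSubgroup_group H) xy yz.
by rewrite -mulgA mulVKg.
Qed.

Canonical lcoset_equiv :=
  EquivRel (lcoset_rel H) lcoset_rel_refl lcoset_rel_sym lcoset_rel_trans.

End Lcosets.

Definition cocompact (H : closedSubgroup) : Prop :=
  compact [set: quotient_topology {eq_quot lcoset_equiv H}].

End ClosedSubgroups.

(* A closed subgroup as a topological group, for the induced topology. *)
Definition subgroup_type (G : topologicalGroupType) (H : closedSubgroup G) :=
  set_type H.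

Section SubgroupType.
Variables (G : topologicalGroupType) (H : closedSubgroup G).
Local Notation S := (subgroup_type H).

HB.instance Definition _ := SubChoice.copy S (set_type H).
HB.instance Definition _ := Topological.copy S (set_type H).
HB.instance Definition _ :=
  SubChoice_isSubGroup.Build G _ S (closedSubgroup_group H).


Lemma subgroup_val_continuous : continuous (\val : S -> G).
Proof. exact: initial_continuous. Qed.

Lemma continuous_subgroup_val (T : topologicalType) (f : T -> S) :
  continuous (\val \o f) -> continuous f.
Proof.
by move=> /continuousP cf; apply/continuousP => _ [B oB <-]; exact: cf.
Qed.

Lemma subgroup_mulg_continuous : continuous (fun x : S * S => x.1 * x.2).
Proof.
apply: continuous_subgroup_val => x.
rewrite (_ : _ \o _ = fun z : S * S => \val z.1 * \val z.2); last first.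
  by apply/funext => z; exact: valM.
apply: (@continuous_comp _ _ _ (fun z : S * S => (\val z.1, \val z.2))
  (fun z : G * G => z.1 * z.2)); last exact: mulg_continuous.
apply: cvg_pair => A nA.
- exists ((\val : S -> G) @^-1` A, setT); last by move=> z [].
  by split; [exact: (subgroup_val_continuous nA) | exact: filterT].
- exists (setT, (\val : S -> G) @^-1` A); last by move=> z [].
  by split; [exact: filterT | exact: (subgroup_val_continuous nA)].
Qed.

Lemma subgroup_invg_continuous : continuous (fun x : S => x^-1).
Proof.
apply: continuous_subgroup_val => x.
rewrite (_ : _ \o _ = fun z : S => (\val z)^-1); last first.
  by apply/funext => z; exact: gmulfV.
move=> A nA.
exact: (@subgroup_val_continuous x _ (@invg_continuous G (\val x) A nA)).
Qed.

Lemma subgroup_one_closed : closed [set (1 : S)].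
Proof.
rewrite (_ : [set _] = (\val : S -> G) @^-1` [set 1]).
  apply: preimage_closed; last exact: one_closed.
  by move=> x _; exact: subgroup_val_continuous.
apply/seteqP; split=> x /=; first by move=> ->; exact: (@val1 G _ S).
by move=> x1; apply: val_inj; apply: etrans x1 (esym (@val1 G _ S)).
Qed.

HB.instance Definition _ := isTopologicalGroup.Build S
  subgroup_mulg_continuous subgroup_invg_continuous subgroup_one_closed.

End SubgroupType.

Section Amenability.
Variable R : realType.

Definition continuous_action (G : topologicalGroupType) (X : topologicalType)
    (act : G -> X -> X) : Prop :=
  [/\ forall x, act 1 x = x,
      forall g h x, act (g * h) x = act g (act h x) &
      continuous (fun p : G * X => act p.1 p.2)].

Definition borel (X : ptopologicalType) := g_sigma_algebraType (@open X).

Definition fixes_probability (G : Type) (H : set G) (X : ptopologicalType)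
    (act : G -> X -> X) : Prop :=
  exists mu : probability (borel X) R,
    forall h, H h -> forall B : set (borel X), measurable B ->
      mu (act h @^-1` B) = mu B.

(* Compact spaces are Hausdorff, and nonempty (the base point of X plays no
   other role). *)
Definition relatively_amenable (G : topologicalGroupType) (H : set G) : Prop :=
  forall X : ptopologicalType, hausdorff_space X -> compact [set: X] ->
  forall act : G -> X -> X, continuous_action act -> fixes_probability H act.

Definition amenable (G : topologicalGroupType) : Prop :=
  relatively_amenable [set: G].

End Amenability.

Section Tree.
Variables d k : nat.

(* The vertices of T_{d,k}: None is the root, and Some (i, [:: j_n; ...; j_1])
   is reached from the root through its i-th child by going successively to
   the j_1-th, ..., j_n-th child; hence Some (i, j :: s) is the j-th child of
   Some (i, s). *)
Definition vertex : Type := option ('I_k * seq 'I_d).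

HB.instance Definition _ := Countable.on vertex.

Definition root : vertex := None.

(* child u v means that v is a child of u. *)
Definition child (u v : vertex) : bool :=
  match v with
  | None => false
  | Some (_, [::]) => u == root
  | Some (i, _ :: s) => u == Some (i, s)
  end.

Definition adjacent (u v : vertex) : bool := child u v || child v u.

(* A set of vertices containing the root is connected if and only if it is
   closed under taking parents. *)
Definition finite_subtree (A : set vertex) : Prop :=
  [/\ finite_set A, A root & forall u v, child u v -> A v -> A u].

Definition boundary (A : set vertex) : set vertex :=
  [set v | ~ A v /\ exists2 u, A u & adjacent u v].

Definition forest_iso (A B : set vertex) (f : vertex -> vertex) : Prop :=
  set_bij (~` A) (~` B) f /\
  forall u v, ~ A u -> ~ A v -> adjacent (f u) (f v) = adjacent u v.

(* The values of almost_map on almost_dom are irrelevant: almost_equiv below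
   ignores them. *)
Record almost_aut := AlmostAut {
  almost_dom : set vertex;
  almost_cod : set vertex;
  almost_map : vertex -> vertex;
  almost_domP : finite_subtree almost_dom;
  almost_codP : finite_subtree almost_cod;
  almost_boundary : boundary almost_dom #= boundary almost_cod;
  almost_mapP : forest_iso almost_dom almost_cod almost_map }.

HB.instance Definition _ := gen_eqMixin almost_aut.
HB.instance Definition _ := gen_choiceMixin almost_aut.

Definition almost_equiv (p q : almost_aut) : Prop :=
  exists2 C, finite_subtree C &
    [/\ almost_dom p `<=` C, almost_dom q `<=` C &
        forall v, ~ C v -> almost_map p v = almost_map q v].

Definition depth (v : vertex) : nat := if v is Some (_, s) then (size s).+1 else 0.

Definition ball (n : nat) : set vertex := [set v | depth v <= n].

Lemma child_depth u v : child u v -> depth v = (depth u).+1.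
Proof. by case: v => [[i [|j s]]|] //= /eqP ->. Qed.

Lemma parent_uniq u u' v : child u v -> child u' v -> u = u'.
Proof. by case: v => [[i [|j s]]|] //= /eqP -> /eqP ->. Qed.

Lemma parentP v : v = root \/ exists u, child u v.
Proof.
case: v => [[i [|j s]]|]; last by left.
  by right; exists root => /=.
by right; exists (Some (i, s)) => /=.
Qed.

Lemma finite_ball n : finite_set (ball n).
Proof.
pose f (o : option ('I_k * n.-bseq 'I_d)) : vertex :=
  if o is Some z then Some (z.1, z.2 : seq 'I_d) else None.
apply: (@sub_finite_set _ _ (f @` setT)); last exact/finite_image/finite_finset.
move=> [[i s]|] /= sn; last by exists None.
by exists (Some (i, Bseq (ltnW sn))).
Qed.

Lemma ball_subtree n : finite_subtree (ball n).
Proof.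
split=> [||u v /child_depth]; [exact: finite_ball | by [] |].
by rewrite /ball /= => -> /ltnW.
Qed.

Lemma finite_bounded (A : set vertex) : finite_set A -> exists n, A `<=` ball n.
Proof.
move=> /finite_seqP[s ->]; exists (\max_(v <- s) depth v) => v /= vs.
exact: leq_bigmax_seq.
Qed.

Lemma almost_equivP p q : almost_equiv p q <->
  exists n, forall v, n < depth v -> almost_map p v = almost_map q v.
Proof.
split=> [[C [/finite_bounded[n Cn] _ _] [_ _ eqC]]|[n eqn]].
  exists n => v nv; apply: eqC => /Cn; rewrite /ball/= leqNgt nv //.
have [/finite_bounded[a Aa] _ _] := almost_domP p.
have [/finite_bounded[b Bb] _ _] := almost_domP q.
exists (ball (maxn n (maxn a b))); first exact: ball_subtree.
split=> [v /Aa|v /Bb|v] /=; rewrite /ball/=.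
- by move=> va; rewrite !leq_max va orbT.
- by move=> va; rewrite !leq_max va !orbT.
- by move=> /negP; rewrite -ltnNge gtn_max => /andP[/eqn].
Qed.

Lemma forest_iso_inv A B f : forest_iso A B f -> exists2 g, forest_iso B A g &
  (forall v, ~ A v -> g (f v) = v) /\ (forall v, ~ B v -> f (g v) = v).
Proof.
move=> [[ffun finj fsurj] fadj].
have /choice[g gP] : forall v, exists u, ~ B v -> ~ A u /\ f u = v.
  move=> v; have [Bv|nBv] := pselect (B v); first by exists root.
  by have [u nAu <-] := fsurj _ nBv; exists u.
have fg v : ~ B v -> f (g v) = v by move=> /gP[].
have gA v : ~ B v -> ~ A (g v) by move=> /gP[].
have gf v : ~ A v -> g (f v) = v.
  move=> nAv; apply: finj; rewrite ?inE; [|by []|].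
  - exact/gA/ffun.
  - exact/fg/ffun.
exists g; last by split.
split; last by move=> u v nBu nBv; rewrite -fadj ?fg //; exact: gA.
split=> [//|u v|u nAu].
- by rewrite !inE => nBu nBv guv; rewrite -[u]fg// guv fg.
- by exists (f u); [exact: ffun | exact: gf].
Qed.

Lemma child_inj (v : vertex) : v <> root -> forall w, child v w ->
  exists j, w = omap (fun z => (z.1, j :: z.2)) v.
Proof.
case: v => // -[i s] _ [[i' [|j s']]|] //= /eqP [-> ->]; by exists j.
Qed.

Lemma child_cons (v : vertex) j :
  v <> root -> child v (omap (fun z => (z.1, j :: z.2)) v).
Proof. by case: v => // -[i s] _ /=. Qed.

(* In a forest T \ A every vertex has d children, so that the roots of the
   components are the vertices of degree d: forest isomorphisms map roots to
   roots. *)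
Lemma forest_iso_root A B f v : finite_subtree A -> finite_subtree B ->
  forest_iso A B f -> ~ A v -> (forall u, child u v -> A u) ->
  forall x, child x (f v) -> B x.
Proof.
move=> [_ Ar Ap] [_ Br Bp] isof nAv vA x xfv; apply: contrapT => nBx.
have [g [[gfun ginj _] gadj] [gf fg]] := forest_iso_inv isof.
have nBfv : ~ B (f v) by case: isof => -[ffun _ _] _; exact: ffun.
have vr : v <> root by move=> vr; apply: nAv; rewrite vr.
have fvr : f v <> root by move=> vr'; apply: nBfv; rewrite vr'.
pose h (o : option 'I_d) : vertex :=
  if o is Some j then omap (fun z => (z.1, j :: z.2)) (f v) else x.
have hadj o : adjacent (f v) (h o).
  by case: o => [j|] /=; rewrite /adjacent ?child_cons ?xfv ?orbT.
have hB o : ~ B (h o).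
  by case: o => [j|] //= /(Bp _ _ (child_cons j fvr)).
have hinj : injective h.
  have hx j : h (Some j) <> x.
    move=> jx; have := child_depth xfv; rewrite -jx.
    rewrite (child_depth (child_cons j fvr)) => /eqP.
    by rewrite ltn_eqF // ltnS leqnSn.
  move=> [j|] [j'|] //; last 2 first.
  - by move/hx.
  - by move/esym/hx.
  by rewrite /h; case: (f v) fvr => [[i s]|] //= _ [->].
have /choice[m mP] : forall o, exists j,
    g (h o) = omap (fun z => (z.1, j :: z.2)) v.
  move=> o; apply: child_inj => //; have := hadj o.
  rewrite -(gadj _ _ nBfv (hB o)) gf//.
  case/orP => // /vA Agh; have := gfun _ (hB o); by [].
have minj : injective m.
  by move=> o o' moo; apply/hinj/ginj; rewrite ?inE ?mP ?moo //; exact: hB.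
by have := leq_card _ minj; rewrite card_option ltnn.
Qed.

Lemma forest_iso_child A B f u v : finite_subtree A -> finite_subtree B ->
  forest_iso A B f -> ~ A u -> ~ A v -> child u v -> child (f u) (f v).
Proof.
move=> Afin Bfin isof.
have [g _ [gf fg]] := forest_iso_inv isof.
have [[ffun finj _] fadj] := isof.
have [n] := ubnP (depth v).
elim: n => // n IHn in u v *; rewrite ltnS => vn nAu nAv uv.
have : adjacent (f u) (f v) by rewrite fadj// /adjacent uv.
case/orP => // fvu; exfalso.
have [[w [wu nAw]]|noparent] := pselect (exists w, child w u /\ ~ A w).
- have fwu : child (f w) (f u).
    by apply: IHn => //; apply: leq_trans vn; rewrite (child_depth uv).
  have wv : w = v.
    rewrite -(gf w)// -(gf v)//; congr g; exact: parent_uniq fwu fvu.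
  move: wu; rewrite wv => /child_depth; rewrite (child_depth uv) => /eqP.
  by rewrite ltn_eqF // ltnS leqnSn.
- apply: (ffun _ nAv); apply: (forest_iso_root Afin Bfin isof nAu _ fvu) => w wu.
  by apply: contrapT => nAw; apply: noparent; exists w.
Qed.

Lemma forest_iso_childE A B f u v : finite_subtree A -> finite_subtree B ->
  forest_iso A B f -> ~ A u -> ~ A v -> child (f u) (f v) = child u v.
Proof.
move=> Afin Bfin isof nAu nAv; apply/idP/idP; last exact: forest_iso_child isof _ _.
have [g isog [gf fg]] := forest_iso_inv isof.
have [[ffun _ _] _] := isof.
move=> /(forest_iso_child Bfin Afin isog (ffun _ nAu) (ffun _ nAv)).
by rewrite !gf.
Qed.

Lemma forest_iso_boundary A B f : finite_subtree A -> finite_subtree B ->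
  forest_iso A B f -> boundary A #= boundary B.
Proof.
move=> Afin Bfin isof.
have bE C v : finite_subtree C ->
    boundary C v <-> ~ C v /\ forall u, child u v -> C u.
  move=> [_ Cr Cp]; split=> [[nCv [u Cu]]|[nCv vC]].
    case/orP => [uv|/Cp/(_ Cu)//]; split=> // w wv.
    by rewrite (parent_uniq wv uv).
  split=> //; have [vr|[u uv]] := parentP v; first by rewrite vr in nCv.
  by exists u; [exact: vC | rewrite /adjacent uv].
have [g isog [gf fg]] := forest_iso_inv isof.
have [[ffun finj _] _] := isof.
apply/card_set_bijP; exists f; split.
- move=> v /(bE _ _ Afin)[nAv vA]; apply/(bE _ _ Bfin); split; first exact: ffun.
  exact: forest_iso_root isof nAv vA.
- by move=> u v; rewrite !inE => -[nAu _] [nAv _]; apply: finj; rewrite inE.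
- move=> v /(bE _ _ Bfin)[nBv vB].
  exists (g v); last exact: fg.
  apply/(bE _ _ Afin); split; first by case: isog => -[gfun _ _] _; exact: gfun.
  exact: forest_iso_root isog nBv vB.
Qed.

Definition mk_almost_aut A B f (Afin : finite_subtree A)
    (Bfin : finite_subtree B) (isof : forest_iso A B f) : almost_aut :=
  AlmostAut Afin Bfin (forest_iso_boundary Afin Bfin isof) isof.

Lemma almost_map_proper p n :
  exists m, forall v, m < depth v -> n < depth (almost_map p v).
Proof.
have [g isog [gf fg]] := forest_iso_inv (almost_mapP p).
have [Afin _ _] := almost_domP p.
have : finite_set (almost_dom p `|` g @` ball n).
  by rewrite finite_setU; split=> //; exact/finite_image/finite_ball.
move=> /finite_bounded[m Am]; exists m => v mv; rewrite ltnNge; apply/negP => vn.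
have nAv : ~ almost_dom p v.
  by move=> Av; have := Am v (or_introl Av); rewrite /ball/= leqNgt mv.
have : ball m v by apply: Am; right; exists (almost_map p v) => //; exact: gf.
by rewrite /ball/= leqNgt mv.
Qed.

Lemma finite_almost_dom p : exists n, forall v, n < depth v -> ~ almost_dom p v.
Proof.
have [/finite_bounded[n An] _ _] := almost_domP p.
by exists n => v nv /An; rewrite /ball/= leqNgt nv.
Qed.

Section Composition.
Variables q p : almost_aut.
Local Notation A := (almost_dom p).
Local Notation B := (almost_cod p).
Local Notation A' := (almost_dom q).
Local Notation B' := (almost_cod q).

Definition comp_dom := A `|` almost_map p @^-1` A'.
Definition comp_cod := B' `|` almost_map q @` (B `\` A').
Definition comp_map := almost_map q \o almost_map p.

Lemma comp_dom_subtree : finite_subtree comp_dom.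
Proof.
have [n nA] := finite_almost_dom q; have [m mP] := almost_map_proper p n.
have [a aP] := finite_almost_dom p.
split.
- apply: (@sub_finite_set _ _ (ball (maxn m a))); last exact: finite_ball.
  move=> v vC; rewrite /ball/= leqNgt gtn_max; apply/negP => /andP[mv av].
  by case: vC => [/(aP _ av)//|]; exact/nA/mP.
- by left; case: (almost_domP p).
- move=> u v uv; have [_ _ Ap] := almost_domP p; have [_ _ A'p] := almost_domP q.
  have [Au|nAu] := pselect (A u); first by left.
  case=> [/(Ap _ _ uv)//|A'v]; right; apply: A'p A'v.
  apply: (forest_iso_child (almost_domP p) (almost_codP p) (almost_mapP p)) => //.
  by move=> /(Ap _ _ uv).
Qed.

Lemma comp_cod_subtree : finite_subtree comp_cod.
Proof.
have [Bfin _ Bp] := almost_codP p; have [B'fin B'r B'p] := almost_codP q.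
split.
- rewrite finite_setU; split=> //; apply: finite_image.
  exact: sub_finite_set Bfin.
- by left.
- move=> u v uv; have [B'u|nB'u] := pselect (B' u); first by left.
  case=> [/(B'p _ _ uv)//|[w [Bw nA'w] wv]]; right.
  have [[_ _ surj] _] := almost_mapP q.
  have [w' nA'w' w'u] := surj _ nB'u.
  exists w' => //; split=> //; apply: Bp Bw.
  rewrite -(forest_iso_childE (almost_domP q) (almost_codP q) (almost_mapP q))//.
  by rewrite wv w'u.
Qed.

Lemma comp_iso : forest_iso comp_dom comp_cod comp_map.
Proof.
have [[pfun pinj psurj] padj] := almost_mapP p.
have [[qfun qinj qsurj] qadj] := almost_mapP q.
have comp_domN v : ~ comp_dom v -> ~ A v /\ ~ A' (almost_map p v).
  by move=> Cv; split=> ?; apply: Cv; [left | right].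
split; last first.
  move=> u v /comp_domN[? ?] /comp_domN[? ?].
  by rewrite /comp_map/= qadj// padj.
split.
- move=> v /comp_domN[nAv nA'v] [|[w [Bw nA'w]]]; first exact: qfun.
  move=> /qinj wv; apply: (pfun _ nAv); rewrite -wv ?inE//.
- move=> u v; rewrite !inE => /comp_domN[? ?] /comp_domN[? ?] /qinj uv.
  by apply: pinj; rewrite ?inE//; apply: uv; rewrite inE.
- move=> v nDv; have nB'v : ~ B' v by move=> ?; apply: nDv; left.
  have [w nA'w wv] := qsurj _ nB'v.
  have nBw : ~ B w by move=> ?; apply: nDv; right; exists w.
  have [u nAu uw] := psurj _ nBw.
  exists u; last by rewrite /comp_map/= uw.
  by case=> //; rewrite /= uw.
Qed.

Definition almost_comp : almost_aut :=
  mk_almost_aut comp_dom_subtree comp_cod_subtree comp_iso.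

End Composition.

Lemma id_iso A : forest_iso A A id.
Proof. by split=> //; split=> // v nAv; exists v. Qed.

Definition almost_id : almost_aut :=
  mk_almost_aut (ball_subtree 0) (ball_subtree 0) (id_iso (ball 0)).

Lemma almost_inv_subproof (p : almost_aut) :
  {g | forest_iso (almost_cod p) (almost_dom p) g &
    (forall v, ~ almost_dom p v -> g (almost_map p v) = v) /\
    (forall v, ~ almost_cod p v -> almost_map p (g v) = v)}.
Proof. exact/cid2/forest_iso_inv/almost_mapP. Qed.

Definition almost_inv (p : almost_aut) : almost_aut :=
  mk_almost_aut (almost_codP p) (almost_domP p) (s2valP (almost_inv_subproof p)).

Lemma almost_mapK p v : ~ almost_dom p v ->
  almost_map (almost_inv p) (almost_map p v) = v.
Proof. by move: v; case: (s2valP' (almost_inv_subproof p)). Qed.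

Definition almost_equivb : rel almost_aut := fun p q => `[< almost_equiv p q >].

Lemma almost_equivb_refl : reflexive almost_equivb.
Proof. by move=> p; apply/asboolP/almost_equivP; exists 0. Qed.

Lemma almost_equivb_sym : symmetric almost_equivb.
Proof.
suff sub p q : almost_equivb p q -> almost_equivb q p.
  by move=> p q; apply/idP/idP; exact: sub.
move=> /asboolP/almost_equivP[n nP]; apply/asboolP/almost_equivP.
by exists n => v /nP.
Qed.

Lemma almost_equivb_trans : transitive almost_equivb.
Proof.
move=> q p r /asboolP/almost_equivP[n nP] /asboolP/almost_equivP[m mP].
apply/asboolP/almost_equivP; exists (maxn n m) => v.
by rewrite gtn_max => /andP[/nP-> /mP].
Qed.

Canonical almost_equiv_rel := EquivRel almost_equivb
  almost_equivb_refl almost_equivb_sym almost_equivb_trans.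

Definition neretin : Type := {eq_quot almost_equiv_rel}.

HB.instance Definition _ := Choice.on neretin.

Definition neretin_class (p : almost_aut) : neretin := \pi_{eq_quot almost_equiv_rel} p.

Lemma neretin_classP p q : neretin_class p = neretin_class q <->
  exists n, forall v, n < depth v -> almost_map p v = almost_map q v.
Proof.
rewrite -almost_equivP /neretin_class; split=> [/eqmodP/asboolP//|pq].
exact/eqmodP/asboolP.
Qed.

Definition neretin_repr (g : neretin) : almost_aut :=
  repr (g : {eq_quot almost_equiv_rel}).

Lemma neretin_reprK g : neretin_class (neretin_repr g) = g.
Proof. exact: reprK. Qed.

(* The product g * h is the composite of h followed by g. *)
Definition neretin_mul (g h : neretin) : neretin :=
  neretin_class (almost_comp (neretin_repr g) (neretin_repr h)).

Definition neretin_one : neretin := neretin_class almost_id.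

Definition neretin_inv (g : neretin) : neretin :=
  neretin_class (almost_inv (neretin_repr g)).

Lemma neretin_mulE p q :
  neretin_mul (neretin_class p) (neretin_class q) =
  neretin_class (almost_comp p q).
Proof.
have /neretin_classP[n np] := neretin_reprK (neretin_class p).
have /neretin_classP[m mq] := neretin_reprK (neretin_class q).
have [a aP] := almost_map_proper q n.
apply/neretin_classP; exists (maxn m a) => v; rewrite gtn_max => /andP[mv av] /=.
by rewrite /comp_map /= mq// np//; exact: aP.
Qed.

Lemma neretin_mulA : associative neretin_mul.
Proof.
move=> f g h; rewrite -[f]neretin_reprK -[g]neretin_reprK -[h]neretin_reprK.
by rewrite !neretin_mulE; apply/neretin_classP; exists 0.
Qed.

Lemma neretin_mul1g : left_id neretin_one neretin_mul.
Proof.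
move=> g; rewrite -[g]neretin_reprK neretin_mulE.
by apply/neretin_classP; exists 0.
Qed.

Lemma neretin_mulg1 : right_id neretin_one neretin_mul.
Proof.
move=> g; rewrite -[g]neretin_reprK neretin_mulE.
by apply/neretin_classP; exists 0.
Qed.

Lemma neretin_mulVg : left_inverse neretin_one neretin_inv neretin_mul.
Proof.
move=> g; rewrite -[X in neretin_mul _ X]neretin_reprK neretin_mulE.
apply/neretin_classP; have [n nP] := finite_almost_dom (neretin_repr g).
by exists n => v /nP; exact: almost_mapK.
Qed.

Lemma neretin_mulgV : right_inverse neretin_one neretin_inv neretin_mul.
Proof.
move=> g; rewrite -[X in neretin_mul X _]neretin_reprK neretin_mulE.
apply/neretin_classP.
have [n nP] := finite_almost_dom (almost_inv (neretin_repr g)).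
exists n => v /nP; rewrite /= /comp_map /=.
by case: (s2valP' (almost_inv_subproof (neretin_repr g))) => _; exact.
Qed.

HB.instance Definition _ := isGroup.Build neretin
  neretin_mulA neretin_mul1g neretin_mulg1 neretin_mulVg neretin_mulgV.

Record tree_aut := TreeAut {
  tree_aut_fun :> vertex -> vertex;
  tree_aut_bij : bijective tree_aut_fun;
  tree_aut_root : tree_aut_fun root = root;
  tree_aut_adjacent : forall u v,
    adjacent (tree_aut_fun u) (tree_aut_fun v) = adjacent u v }.

HB.instance Definition _ := gen_eqMixin tree_aut.
HB.instance Definition _ := gen_choiceMixin tree_aut.

Lemma tree_autP (a b : tree_aut) : a =1 b -> a = b.
Proof.
case: a b => [f fb fr fa] [g gb gr ga] /= /funext fg; subst g.
by congr TreeAut; exact: Prop_irrelevance.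
Qed.

Definition tree_aut_id : tree_aut.
Proof. by exists id => //; exists id. Defined.

Definition tree_aut_comp (a b : tree_aut) : tree_aut.
Proof.
exists (a \o b).
- exact: bij_comp (tree_aut_bij a) (tree_aut_bij b).
- by rewrite /= !tree_aut_root.
- by move=> u v /=; rewrite !tree_aut_adjacent.
Defined.

Lemma tree_aut_inv_subproof (a : tree_aut) :
  {b : tree_aut | cancel a b & cancel b a}.
Proof.
apply: cid2; have [b ab ba] := tree_aut_bij a.
have bij : bijective b by exists a.
have br : b root = root by rewrite -{1}(tree_aut_root a) ab.
have badj u v : adjacent (b u) (b v) = adjacent u v.
  by rewrite -(tree_aut_adjacent a) !ba.
by exists (TreeAut bij br badj).
Qed.

Definition tree_aut_inv (a : tree_aut) : tree_aut :=
  s2val (tree_aut_inv_subproof a).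

Lemma tree_aut_mulA : associative tree_aut_comp.
Proof. by move=> a b c; exact: tree_autP. Qed.

Lemma tree_aut_mul1g : left_id tree_aut_id tree_aut_comp.
Proof. by move=> a; exact: tree_autP. Qed.

Lemma tree_aut_mulg1 : right_id tree_aut_id tree_aut_comp.
Proof. by move=> a; exact: tree_autP. Qed.

Lemma tree_aut_mulVg : left_inverse tree_aut_id tree_aut_inv tree_aut_comp.
Proof.
by move=> a; apply: tree_autP => v; exact: (s2valP (tree_aut_inv_subproof a)).
Qed.

Lemma tree_aut_mulgV : right_inverse tree_aut_id tree_aut_inv tree_aut_comp.
Proof.
by move=> a; apply: tree_autP => v; exact: (s2valP' (tree_aut_inv_subproof a)).
Qed.

HB.instance Definition _ := isGroup.Build tree_aut
  tree_aut_mulA tree_aut_mul1g tree_aut_mulg1 tree_aut_mulVg tree_aut_mulgV.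

Lemma tree_autK (a : tree_aut) : cancel a (a^-1)%g.
Proof. exact: (s2valP (tree_aut_inv_subproof a)). Qed.

Lemma tree_autVK (a : tree_aut) : cancel (a^-1)%g a.
Proof. exact: (s2valP' (tree_aut_inv_subproof a)). Qed.

(* The topology of Aut(T_{d,k}) as the inverse limit of the automorphism groups
   of the balls. *)
Definition tree_aut_open : set (set tree_aut) :=
  [set U : set tree_aut | forall a : tree_aut, U a ->
    exists n, forall b : tree_aut, (forall v, ball n v -> b v = a v) -> U b].

Lemma tree_aut_openT : tree_aut_open setT.
Proof. by move=> a _; exists 0. Qed.

Lemma tree_aut_openI : setI_closed tree_aut_open.
Proof.
move=> U V oU oV a [/oU[n nU] /oV[m mV]]; exists (maxn n m) => b ab.
split; [apply: nU | apply: mV] => v vn; apply: ab; rewrite /ball/= leq_max.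
  by rewrite (vn : is_true _).
by rewrite (vn : is_true _) orbT.
Qed.

Lemma tree_aut_open_bigcup (I : Type) (U : I -> set tree_aut) :
  (forall i, tree_aut_open (U i)) -> tree_aut_open (\bigcup_i U i).
Proof. by move=> oU a [i _ /oU[n nU]]; exists n => b /nU Ub; exists i. Qed.

HB.instance Definition _ := isOpenTopological.Build tree_aut
  tree_aut_openT tree_aut_openI tree_aut_open_bigcup.

Lemma tree_aut_openW (U : set tree_aut) : tree_aut_open U -> open U.
Proof. by []. Qed.

Lemma tree_aut_iso (a : tree_aut) : forest_iso (ball 0) (ball 0) a.
Proof.
have [b ab ba] := tree_aut_bij a.
have ball0 v : ball 0 v <-> v = root.
  by rewrite /ball/= leqn0; case: v => [[]|].
split; last by move=> u v _ _; exact: tree_aut_adjacent.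
split=> [v /ball0 vr /ball0 avr|u v _ _|v /ball0 vr].
- by apply: vr; rewrite -(ab v) avr -{1}(tree_aut_root a) ab.
- exact: (can_inj ab).
- exists (b v) => // /ball0 bvr; apply: vr.
  by rewrite -(ba v) bvr tree_aut_root.
Qed.

Definition neretin_of_aut (a : tree_aut) : neretin :=
  neretin_class (mk_almost_aut (ball_subtree 0) (ball_subtree 0) (tree_aut_iso a)).

Lemma neretin_of_autM a b :
  neretin_of_aut (a * b) = neretin_of_aut a * neretin_of_aut b.
Proof. by apply/esym/(etrans (neretin_mulE _ _))/neretin_classP; exists 0. Qed.

Lemma neretin_of_aut1 : neretin_of_aut 1 = 1.
Proof. by apply/neretin_classP; exists 0. Qed.

Lemma neretin_of_autV a : neretin_of_aut a^-1 = (neretin_of_aut a)^-1.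
Proof.
apply: (mulgI (neretin_of_aut a)).
by rewrite -neretin_of_autM !mulgV neretin_of_aut1.
Qed.

(* The topology for which the inclusion neretin_of_aut is continuous and open
   (neretin_of_aut_continuous and neretin_of_aut_open below); the lemma
   neretin_open_unique shows that it is the only such group topology. *)
Definition neretin_open : set (set neretin) :=
  [set U | forall g, open [set a | U (g * neretin_of_aut a)]].

Lemma neretin_openT : neretin_open setT.
Proof. by move=> g; exact: openT. Qed.

Lemma neretin_openI : setI_closed neretin_open.
Proof. by move=> U V oU oV g; exact: openI (oU g) (oV g). Qed.

Lemma neretin_open_bigcup (I : Type) (U : I -> set neretin) :
  (forall i, neretin_open (U i)) -> neretin_open (\bigcup_i U i).
Proof.
move=> oU g; apply: (@bigcup_open tree_aut I setT
  (fun i => [set a | U i (g * neretin_of_aut a)])).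
by move=> i _; exact: oU.
Qed.

HB.instance Definition _ := isOpenTopological.Build neretin
  neretin_openT neretin_openI neretin_open_bigcup.

Definition fixator (n : nat) : set tree_aut :=
  [set a | forall v, ball n v -> a v = v].

Lemma fixatorM n a b : fixator n a -> fixator n b -> fixator n (a * b).
Proof. by move=> na nb v vn; rewrite /= nb // na. Qed.

Lemma fixatorS n m : n <= m -> fixator m `<=` fixator n.
Proof. by move=> nm a ma v vn; apply: ma; exact: leq_trans vn nm. Qed.

Lemma fixator_ldiv n (a b : tree_aut) : (forall v, ball n v -> b v = a v) <->
  fixator n (a^-1 * b).
Proof.
have [aK Ka] := (tree_autK a, tree_autVK a).
split=> ab v vn; first by rewrite /= ab// aK.
by rewrite -[RHS]/(a v) -{2}(ab v vn) /= Ka.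
Qed.

Lemma nbhs_neretinP (g : neretin) (U : set neretin) :
  nbhs g U <-> exists n, forall a, fixator n a -> U (g * neretin_of_aut a).
Proof.
split=> [[V [oV Vg VU]]|[n nU]].
  have [|n nV] := oV g 1; first by rewrite /= neretin_of_aut1 mulg1.
  by exists n => a na; apply/VU/nV => v /na.
exists [set h | exists n, forall a, fixator n a -> U (h * neretin_of_aut a)].
split; last 1 first.
- by move=> h [m /(_ 1)]; rewrite neretin_of_aut1 mulg1; exact.
- suff: neretin_open [set h | exists n, forall a, fixator n a ->
      U (h * neretin_of_aut a)] by [].
  move=> h; apply: tree_aut_openW => a [m mU]; exists m => b /fixator_ldiv ab; exists m => c mc.
  have := mU (a^-1 * b * c) (fixatorM ab mc).
  by rewrite !neretin_of_autM neretin_of_autV -!mulgA mulVKg.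
- by exists n.
Qed.

Lemma fixator_conj (h : neretin) n : exists m, forall a, fixator m a ->
  exists2 b, fixator n b & neretin_of_aut a * h = h * neretin_of_aut b.
Proof.
have := neretin_reprK h; move: (neretin_repr h) => p <- {h}.
have [g isog [gf fg]] := forest_iso_inv (almost_mapP p).
have [[ffun finj fsurj] fadj] := almost_mapP p.
have [[gfun ginj gsurj] gadj] := isog.
have [Afin Ar Ap] := almost_domP p; have [Bfin Br Bp] := almost_codP p.
have [N0 AN0] := finite_bounded Afin.
pose N := (maxn n N0).+1.
have AN v : almost_dom p v -> ball N v.
  by move=> /AN0; rewrite /ball/= => vN0; rewrite leqW// leq_max vN0 orbT.
have [m mP] : exists m, almost_cod p `|` almost_map p @` ball N `<=` ball m.
  apply: finite_bounded; rewrite finite_setU; split=> //.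
  exact/finite_image/finite_ball.
exists m => a ma.
have aB v : almost_cod p v -> a v = v by move=> Bv; apply/ma/mP; left.
have [aK Ka] := (tree_autK a, tree_autVK a).
have aVB v : almost_cod p v -> (a^-1)%g v = v by move=> /aB {1}<-; rewrite aK.
have naB v : ~ almost_cod p v -> ~ almost_cod p (a v).
  by move=> nBv Bav; apply: nBv; rewrite -[v]aK aVB.
have naVB v : ~ almost_cod p v -> ~ almost_cod p ((a^-1)%g v).
  by move=> nBv Bav; apply: nBv; rewrite -[v]Ka aB.
pose conjf (c : tree_aut) v :=
  if v \in almost_dom p then v else g (c (almost_map p v)).
have conjA c v : almost_dom p v -> conjf c v = v.
  by move=> Av; rewrite /conjf mem_set.
have conjN c v : ~ almost_dom p v -> conjf c v = g (c (almost_map p v)).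
  by move=> Av; rewrite /conjf memNset.
have conjfK (c c' : tree_aut) : cancel c c' ->
    (forall v, ~ almost_cod p v -> ~ almost_cod p (c v)) ->
    cancel (conjf c) (conjf c').
  move=> cc' nc v; have [Av|nAv] := pselect (almost_dom p v).
    by rewrite !conjA.
  have nBv := ffun _ nAv.
  rewrite (conjN c)// conjN; last exact/gfun/nc.
  by rewrite fg ?cc' ?gf//; exact: nc.
have bbij : bijective (conjf a).
  by exists (conjf a^-1); exact: conjfK.
have bfix v : ball N v -> conjf a v = v.
  move=> vN; have [Av|nAv] := pselect (almost_dom p v); first exact: conjA.
  by rewrite conjN// ma ?gf//; apply: mP; right; exists v.
have bA v : ~ almost_dom p v -> ~ almost_dom p (conjf a v).
  by move=> nAv; rewrite conjN//; exact/gfun/naB/ffun.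
have adjN u v : almost_dom p u -> adjacent u v -> ball N v.
  move=> /AN0; rewrite /ball/= => uN0 /orP[] /child_depth E.
    by rewrite E ltnS leq_max uN0 orbT.
  by rewrite leqW// leq_max (leq_trans _ uN0) ?orbT// E.
have adjA u v : almost_dom p u ->
    adjacent (conjf a u) (conjf a v) = adjacent u v.
  move=> Au; rewrite (conjA _ _ Au); apply/idP/idP => uv.
    by have /bfix/(bij_inj bbij) <- := adjN _ _ Au uv.
  by rewrite bfix//; exact: adjN uv.
have adjC u v : adjacent u v = adjacent v u by rewrite /adjacent orbC.
have badj u v : adjacent (conjf a u) (conjf a v) = adjacent u v.
  have [Au|nAu] := pselect (almost_dom p u); first exact: adjA.
  have [Av|nAv] := pselect (almost_dom p v).
    by rewrite adjC adjA// adjC.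
  rewrite !conjN// gadj; [|exact/naB/ffun|exact/naB/ffun].
  by rewrite tree_aut_adjacent fadj.
exists (TreeAut bbij (conjA a _ Ar) badj).
  by move=> v vn; apply: bfix; rewrite /ball/= leqW// leq_max (vn : is_true _).
rewrite -[LHS]/(neretin_mul _ _) -[RHS]/(neretin_mul _ _) !neretin_mulE.
have [l lP] := finite_almost_dom p.
apply/neretin_classP; exists l => v /lP nAv; rewrite /= /comp_map /=.
by rewrite conjN// fg//; exact/naB/ffun.
Qed.

Lemma neretin_mulg_continuous :
  continuous (fun x : neretin * neretin => x.1 * x.2).
Proof.
move=> [g h] W /nbhs_neretinP[n nW].
have [m mP] := fixator_conj h n.
exists ((fun x => g * x) @` (neretin_of_aut @` fixator m),
        (fun x => h * x) @` (neretin_of_aut @` fixator n)).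
  by split; apply/nbhs_neretinP; [exists m|exists n] => a am;
    exists (neretin_of_aut a) => //; exists a.
move=> [x y] /= [[_ [a am <-] <-] [_ [b bn <-] <-]].
have [c cn ac] := mP a am.
rewrite /= -mulgA (mulgA (neretin_of_aut a)) ac -mulgA mulgA -neretin_of_autM.
by apply: nW; exact: fixatorM.
Qed.

Lemma fixatorV n a : fixator n a -> fixator n a^-1.
Proof.
move=> an; rewrite -[a^-1]mulg1; apply/fixator_ldiv => v vn.
by rewrite an.
Qed.

Lemma neretin_invg_continuous : continuous (fun x : neretin => x^-1).
Proof.
move=> g W /nbhs_neretinP[n nW].
have [m mP] := fixator_conj g^-1 n.
apply/nbhs_neretinP; exists m => a /fixatorV am /=.
have [b bn ab] := mP _ am.
by rewrite invgM -neretin_of_autV ab; exact: nW.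
Qed.

Lemma neretin_one_closed : closed [set (1 : neretin)].
Proof.
rewrite -openC openE => g /= g1; apply/nbhs_neretinP.
move: g1; have := neretin_reprK g; move: (neretin_repr g) => p <- {g} p1.
have [N NP] := finite_almost_dom p.
have [v vN pv] : exists2 v, N.+1 < depth v & almost_map p v <> v.
  apply: contrapT => nv; apply/p1/neretin_classP; exists N.+1 => v vN.
  by apply: contrapT => pv; apply: nv; exists v.
exists (depth v) => b bv.
move=> /(etrans (esym (neretin_mulE _ _)))/neretin_classP[M MP].
set q := almost_comp p _ in MP.
have bvv : b v = v by apply: bv; exact: leqnn.
have qv : almost_map q v <> v by rewrite /= /comp_map/= bvv.
have vC : ~ almost_dom q v.
  case=> /=; first by rewrite /ball/= leqn0 => /eqP v0; rewrite v0 in vN.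
  by rewrite bvv; apply: NP; exact: ltnW.
have [_ _ Cp] := almost_domP q.
have [j _] : exists j : 'I_d, true.
  by case: (v) vN => [[i [|j s]]|] //= _; exists j.
have desc m : exists w, [/\ ~ almost_dom q w, almost_map q w <> w & m < depth w].
  elim: m => [|m [w [wC qw mw]]]; first by exists v; split=> //; exact: leq_trans vN.
  have wr : w <> root by move=> wr; rewrite wr in mw.
  have wj := child_cons j wr; set w' := omap _ _ in wj.
  have w'C : ~ almost_dom q w' by move=> /(Cp _ _ wj).
  exists w'; split=> //; last by rewrite (child_depth wj).
  move=> qw'; apply: qw; apply: (parent_uniq _ wj); rewrite -qw'.
  by apply: (forest_iso_child (almost_domP q) (almost_codP q) (almost_mapP q)).
by have [w [_ qw /MP]] := desc M.
Qed.

HB.instance Definition _ := isTopologicalGroup.Build neretin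
  neretin_mulg_continuous neretin_invg_continuous neretin_one_closed.

Lemma neretin_of_aut_continuous : continuous neretin_of_aut.
Proof.
apply/continuousP => U /(_ 1).
by rewrite (_ : [set a | _] = neretin_of_aut @^-1` U)//; apply/seteqP; split=> a;
  rewrite /= mul1g.
Qed.

Lemma neretin_of_aut_open (U : set tree_aut) :
  open U -> open (neretin_of_aut @` U).
Proof.
move=> oU; rewrite openE => _ [a /oU[n nU] <-]; apply/nbhs_neretinP.
exists n => b bn; exists (a * b); last exact: neretin_of_autM.
by apply: nU => v vn; rewrite /= bn.
Qed.

Lemma neretin_open_unique (op : set (set neretin)) :
  (forall (I : Type) (U : I -> set neretin),
    (forall i, op (U i)) -> op (\bigcup_i U i)) ->
  (forall g U, op U -> op [set h | U (g * h)]) ->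
  (forall U, op U -> open (neretin_of_aut @^-1` U)) ->
  (forall U, open U -> op (neretin_of_aut @` U)) ->
  op = open.
Proof.
move=> opU opM opc opo; apply/seteqP; split=> U.
  by move=> oU; suff: neretin_open U by []; move=> g; exact: opc (opM g U oU).
move=> oU; rewrite (_ : U = \bigcup_g
    [set h | (neretin_of_aut @` [set a | U (g * neretin_of_aut a)]) (g^-1 * h)]).
  by apply: opU => g; exact/opM/opo/oU.
apply/seteqP; split=> [g Ug|h [g _ [a /= Uga gh]]].
  exists g => //; exists 1 => /=; first by rewrite neretin_of_aut1 mulg1.
  by rewrite mulVg neretin_of_aut1.
by rewrite gh mulVKg in Uga.
Qed.

End Tree.

(* Main.v *)
From HB Require Import structures.
Require Import Defs.
From mathcomp Require Import all_boot all_order all_algebra.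
From mathcomp Require Import all_classical all_reals.
From mathcomp Require Import topology measure lra.

Set Implicit Arguments.
Unset Strict Implicit.
Unset Printing Implicit Defensive.

Import Order.TTheory.

Local Open Scope classical_set_scope.
Local Open Scope quotient_scope.
Local Open Scope group_scope.

(** The proof produces a compact space on which the Neretin group G has a point
    that is free and to which every probability measure can be pushed.

    Its points, the precedences, are relations between clopen sets of ends, to be
    read as: U is met before V.  They are asymmetric, monotone, and total on
    disjoint sets.  Enumerating a dense sequence x_0, x_1, ... of ends gives a
    precedence y* : U is met before V if some x_i lies in U while x_0, ..., x_i
    all avoid V.  No c <> 1 preserves y*.  Indeed, if x_i is the first end of the
    sequence that c moves and V is a small enough neighbourhood of x_i, then V
    comes before both c V and c^-1 V; if c preserved y*, the second fact would
    make c V come before V.  This displacement only involves c V, c^-1 V and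
    finitely many x_j, so it persists for all elements near c ([near_displaces]).

    Every probability measure mu on precedences is moved close to y* by some q in
    G ([steer]).  The reason is that a clopen set of ends can be compressed,
    inside a larger one, into any ball of the difference ([compress]): among three
    disjoint balls of a clopen set F, one is met before the rest of F with chance
    at most 1/3, and an element supported in F that compresses F minus the next
    neighbourhood into that ball makes this neighbourhood likely to be met first.

    If H is relatively amenable, take mu to be H-invariant.  For h in H, the
    element c = q h q^-1 preserves the translate of mu, which makes V before c V
    and V before c^-1 V likely as soon as c displaces V at the scale controlled by
    q; but invariance turns the latter into c V before V, and two incompatible
    events cannot both have chance above 1/2 ([conj_not_displaces]).

    A compact set that avoids 1 consists of elements that are displaced at one
    common scale, so some conjugate of H avoids it: H is not confined.  If H is
    cocompact, the elements q found at finer and finer scales accumulate modulo H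
    at some g0; then for h <> 1 in H the conjugate g0 h g0^-1 is displaced, hence
    so are the nearby conjugates of H by q, which is absurd.  The trivial group is
    not cocompact because G is not compact: the exchanges of a fixed ball with
    smaller and smaller ones have no accumulation point. *)

(** * The action on the ends of the tree *)

Section Ends.
Variables d k : nat.
Local Notation vertex := (vertex d k).
Local Notation root := (Defs.root d k).
Local Notation neretin := (neretin d k).

Implicit Types (u v w : vertex) (n m : nat).

Definition parent v : vertex :=
  if v is Some (i, _ :: s) then Some (i, s) else None.

Lemma childE u v : child u v = (v != root) && (u == parent v).
Proof. by case: v => [[i [|j s]]|]. Qed.

(** The vertex at depth n on the path from the root to v, and v itself when v is
    less deep than that. *)
Definition ancestor n v : vertex := iter (depth v - n) parent v.

Lemma ancestor_depth v : ancestor (depth v) v = v.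
Proof. by rewrite /ancestor subnn. Qed.

Lemma ancestor_child n u v :
  child u v -> n <= depth u -> ancestor n v = ancestor n u.
Proof.
move=> uv nu; rewrite /ancestor (child_depth uv) subSn// iterSr.
by move: uv; rewrite childE => /andP[_ /eqP ->].
Qed.

Lemma child_ancestor n v : n < depth v -> child (ancestor n v) (ancestor n.+1 v).
Proof.
move: {2}(depth v) (leqnn (depth v)) => m; elim: m v => [v|m IH v vm nv].
  by rewrite leqn0 => /eqP ->.
have [vr|[u uv]] := parentP v; first by rewrite vr in nv.
have uE := child_depth uv.
have [nu|un] := ltnP n (depth u).
  rewrite !(ancestor_child uv) ?(ltnW nu)//.
  by apply: IH => //; rewrite -ltnS -uE.
have -> : n = depth u by apply/eqP; rewrite eqn_leq un andbT -ltnS -uE.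
by rewrite (ancestor_child uv)// ancestor_depth -uE ancestor_depth.
Qed.

Lemma depth_ancestor n v : n <= depth v -> depth (ancestor n v) = n.
Proof.
elim: n v => [|n IH] v nv.
  rewrite /ancestor subn0; case: v {nv} => // -[i s] .
  elim: s => // j s IH.
  by rewrite -[depth (Some (i, j :: s))]/(depth (Some (i, s))).+1 iterSr.
by rewrite (child_depth (child_ancestor nv)) IH// ltnW.
Qed.

(** An end of a rooted tree is the same as an infinite path from the root. *)
Record ray := Ray {
  ray_vertex :> nat -> vertex;
  ray_root : ray_vertex 0 = root;
  ray_child : forall n, child (ray_vertex n) (ray_vertex n.+1) }.

Lemma ray_eq (x y : ray) : x =1 y -> x = y.
Proof.
case: x y => [f f0 fc] [g g0 gc] /= /funext fg; subst g.
by congr Ray; exact: Prop_irrelevance.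
Qed.

Lemma depth_ray (x : ray) n : depth (x n) = n.
Proof.
by elim: n => [|n IH]; rewrite ?ray_root// (child_depth (ray_child x n)) IH.
Qed.

Lemma ancestor_ray (x : ray) n m : n <= m -> ancestor n (x m) = x n.
Proof.
elim: m => [|m IH]; first by rewrite leqn0 => /eqP ->; rewrite ray_root.
rewrite leq_eqVlt => /orP[/eqP ->|].
  by rewrite -{1}(depth_ray x m.+1) ancestor_depth.
by rewrite ltnS => nm; rewrite (ancestor_child (ray_child x m)) ?depth_ray// IH.
Qed.

Definition on_ray (x : ray) v := x (depth v) = v.

Lemma on_rayE (x : ray) v n : on_ray x v -> n <= depth v -> x n = ancestor n v.
Proof. by move=> <-; rewrite depth_ray => nv; rewrite ancestor_ray. Qed.

Lemma on_rays_eq (x y : ray) :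
  (forall n, exists v, [/\ n <= depth v, on_ray x v & on_ray y v]) -> x = y.
Proof.
move=> H; apply: ray_eq => n; have [v [nv xv yv]] := H n.
by rewrite (on_rayE xv)// (on_rayE yv).
Qed.

(** A path that goes down from any vertex extends uniquely to a ray; this is how
    the image of a ray under a partially defined map is completed. *)
Section RayThrough.
Variables (w : nat -> vertex) (wP : forall n, child (w n) (w n.+1)).

Lemma depth_chain n : depth (w n) = depth (w 0) + n.
Proof. by elim: n => [|n IH]; rewrite ?addn0// (child_depth (wP n)) IH addnS. Qed.

Lemma leq_depth_chain n : n <= depth (w n).
Proof. by rewrite depth_chain leq_addl. Qed.

Lemma ancestor_chain j n m : n <= m -> j <= depth (w n) ->
  ancestor j (w m) = ancestor j (w n).
Proof.
move=> + jn; elim: m => [|m IH]; first by rewrite leqn0 => /eqP ->.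
rewrite leq_eqVlt => /orP[/eqP ->//|]; rewrite ltnS => nm.
rewrite (ancestor_child (wP m)) ?IH// (leq_trans jn)//.
by rewrite (depth_chain n) (depth_chain m) leq_add2l.
Qed.

Lemma ray_through_root : ancestor 0 (w 0) = root.
Proof.
by have := depth_ancestor (leq0n (depth (w 0))); case: (ancestor _ _) => [[]|].
Qed.

Lemma ray_through_child n : child (ancestor n (w n)) (ancestor n.+1 (w n.+1)).
Proof.
rewrite -(@ancestor_chain n n n.+1) ?leq_depth_chain//.
exact/child_ancestor/leq_depth_chain.
Qed.

Definition ray_through := Ray ray_through_root ray_through_child.

Lemma ray_throughP n : on_ray ray_through (w n).
Proof.
rewrite /on_ray /= -[RHS]ancestor_depth.
by rewrite (@ancestor_chain _ n)// leq_depth_chain.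
Qed.

End RayThrough.

Definition dom_bound (p : almost_aut d k) : nat :=
  sval (cid (finite_almost_dom p)).

Lemma dom_boundP p v : dom_bound p < depth v -> ~ almost_dom p v.
Proof. by move: v; exact: svalP (cid (finite_almost_dom p)). Qed.

(** Starts below the depth [dom_bound p], where the map is meaningful. *)
Definition act_chain (p : almost_aut d k) (x : ray) n : vertex :=
  almost_map p (x ((dom_bound p).+1 + n)).

Lemma act_chainP p x n : child (act_chain p x n) (act_chain p x n.+1).
Proof.
apply: (forest_iso_child (almost_domP p) (almost_codP p) (almost_mapP p)).
- by apply: dom_boundP; rewrite depth_ray leq_addr.
- by apply: dom_boundP; rewrite depth_ray leq_addr.
- by rewrite addnS; exact: ray_child.
Qed.

Definition act (g : neretin) (x : ray) : ray :=
  ray_through (act_chainP (neretin_repr g) x).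

Lemma act_class p : exists N, forall x n, N <= n ->
  on_ray (act (neretin_class p) x) (almost_map p (x n)).
Proof.
have /neretin_classP[N NP] := neretin_reprK (neretin_class p).
set q := neretin_repr (neretin_class p) in NP.
exists (maxn N (dom_bound q)).+1 => x n; rewrite gtn_max => /andP[Nn qn].
rewrite -NP ?depth_ray// -(subnKC qn); exact: ray_throughP.
Qed.

(** Two rays that share vertices of arbitrarily large depth are equal. *)
Lemma act_unique p (x y : ray) N :
  (forall n, N <= n -> on_ray y (almost_map p (x n))) ->
  act (neretin_class p) x = y.
Proof.
move=> yP; have [M MP] := act_class p; apply: on_rays_eq => n.
have [m mP] := almost_map_proper p n.
exists (almost_map p (x (maxn m.+1 (maxn N M)))).
split; first by apply/ltnW/mP; rewrite depth_ray leq_max leqnn.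
  by apply: MP; rewrite !leq_max leqnn !orbT.
by apply: yP; rewrite !leq_max leqnn !orbT.
Qed.

(** The vertex at depth n of the image is read off a single vertex of the ray. *)
Lemma act_uniform (g : neretin) n : exists m, forall x y : ray,
  x m = y m -> act g x n = act g y n.
Proof.
exists ((dom_bound (neretin_repr g)).+1 + n) => x y xy /=.
by rewrite /act_chain xy.
Qed.

Lemma act1 x : act 1 x = x.
Proof.
by apply: (@act_unique _ x x 0) => n _; rewrite /on_ray/= depth_ray.
Qed.

Lemma actM g h x : act (g * h) x = act g (act h x).
Proof.
rewrite -[g]neretin_reprK -[h]neretin_reprK.
move: (neretin_repr g) (neretin_repr h) => p q.
rewrite -[_ * _]/(neretin_mul _ _) neretin_mulE.
have [N NP] := act_class p; have [M MP] := act_class q.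
have [m mP] := almost_map_proper q N.
apply: (@act_unique _ x _ (maxn m.+1 M)) => n; rewrite geq_max => /andP[mn Mn].
have qn : N < depth (almost_map q (x n)) by apply: mP; rewrite depth_ray.
by rewrite /= /comp_map /= -(MP x n Mn); apply/NP/ltnW.
Qed.

Lemma actK g : cancel (act g) (act g^-1).
Proof. by move=> x; rewrite -actM mulVg act1. Qed.

Lemma actVK g : cancel (act g^-1) (act g).
Proof. by move=> x; rewrite -actM mulgV act1. Qed.

Lemma tree_aut_child (a : tree_aut d k) u v : child u v -> child (a u) (a v).
Proof.
have [->|/eqP ur] := eqVneq u root.
  rewrite tree_aut_root => rv.
  have : adjacent (a root) (a v) by rewrite tree_aut_adjacent /adjacent rv.
  by rewrite tree_aut_root /adjacent [child _ root]/= orbF.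
move=> uv; have ball0 := ball_subtree d k 0.
apply: (forest_iso_child ball0 ball0 (tree_aut_iso a)) => //.
  by rewrite /Defs.ball/= leqn0; case: u ur {uv} => [[]|].
by rewrite /Defs.ball/= leqn0 (child_depth uv).
Qed.

Lemma act_aut (a : tree_aut d k) (x : ray) n :
  act (neretin_of_aut a) x n = a (x n).
Proof.
have y0 : a (x 0) = root by rewrite ray_root tree_aut_root.
pose y := @Ray (a \o x) y0 (fun n => tree_aut_child a (ray_child x n)).
rewrite /neretin_of_aut (@act_unique _ x y 0)// => m _.
by have := depth_ray y m; rewrite /on_ray /= => ->.
Qed.

End Ends.

(** * Clopen sets of ends *)

Section Clopen.
Variables d k : nat.
Local Notation vertex := (vertex d k).
Local Notation root := (Defs.root d k).
Local Notation neretin := (neretin d k).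
Local Notation ray := (ray d k).

Implicit Types (u v w : vertex) (n m : nat) (U V : set ray) (x y : ray).

Definition shadow v : set ray := [set x | on_ray x v].

Definition determined n U := forall x y, x n = y n -> U x -> U y.

(** As the space of ends is compact, these are exactly its clopen sets. *)
Definition ray_clopen U := exists n, determined n U.

Lemma determinedS n m U : n <= m -> determined n U -> determined m U.
Proof.
move=> nm nU x y xy; apply: nU.
by rewrite -(ancestor_ray x nm) -(ancestor_ray y nm) xy.
Qed.

Lemma determinedC n U : determined n U -> determined n (~` U).
Proof. by move=> nU x y /esym xy Ux /(nU _ _ xy). Qed.

Lemma determinedI n U V :
  determined n U -> determined n V -> determined n (U `&` V).
Proof. by move=> nU nV x y xy [/(nU _ _ xy) Uy /(nV _ _ xy)]. Qed.

Lemma ray_clopenC U : ray_clopen U -> ray_clopen (~` U).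
Proof. by move=> [n nU]; exists n; exact: determinedC. Qed.

Lemma ray_clopenI U V : ray_clopen U -> ray_clopen V -> ray_clopen (U `&` V).
Proof.
move=> [n nU] [m mV]; exists (maxn n m); apply: determinedI.
  by apply: determinedS nU; rewrite leq_maxl.
by apply: determinedS mV; rewrite leq_maxr.
Qed.

Lemma determined_shadow v : determined (depth v) (shadow v).
Proof. by rewrite /shadow /on_ray /= => x y /= ->. Qed.

Lemma ray_clopen_shadow v : ray_clopen (shadow v).
Proof. by exists (depth v); exact: determined_shadow. Qed.

Lemma ray_clopen_act (g : neretin) U : ray_clopen U -> ray_clopen (act g @^-1` U).
Proof.
move=> [n nU]; have [m mP] := act_uniform g n.
by exists m => x y /mP; exact: nU.
Qed.

(** Stabilizers of clopen sets are open. *)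
Lemma near_act (g : neretin) U : ray_clopen U ->
  \forall h \near g, act h @^-1` U = act g @^-1` U.
Proof.
move=> [n nU]; have [m mP] := act_uniform g n.
apply/nbhs_neretinP; exists m => a am.
have ax x : act (g * neretin_of_aut a) x n = act g x n.
  by rewrite actM; apply: mP; rewrite act_aut am// /Defs.ball/= depth_ray.
by apply/seteqP; split=> x /=; apply: nU; rewrite ax.
Qed.

Lemma shadow_child u v : child u v -> shadow v `<=` shadow u.
Proof.
move=> uv x xv; rewrite /shadow/= /on_ray (on_rayE xv); last first.
  by rewrite (child_depth uv).
by rewrite (ancestor_child uv)// ancestor_depth.
Qed.

Lemma shadow_depth u v x : depth u = depth v ->
  shadow u x -> shadow v x -> u = v.
Proof. by rewrite /shadow/= /on_ray => -> -> . Qed.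

(** The subtrees below the vertices other than the root are pairwise isomorphic;
    these vertices are handled through their coordinates. *)
Definition node (a : 'I_k * seq 'I_d) : vertex := Some a.
Definition kid (a : 'I_k * seq 'I_d) j := (a.1, j :: a.2).

Lemma shadow_kid a j : shadow (node (kid a j)) `<=` shadow (node a).
Proof. by apply: shadow_child; case: a => i s /=. Qed.

Lemma shadow_kids a j j' : j != j' ->
  shadow (node (kid a j)) `&` shadow (node (kid a j')) = set0.
Proof.
move=> /eqP jj'; rewrite -subset0 => x [xj xj']; apply: jj'.
by have [] := @shadow_depth (node (kid a j)) (node (kid a j')) x erefl xj xj'.
Qed.

Section Extension.
Variable j0 : 'I_d.

Lemma extend_chain (a : 'I_k * seq 'I_d) n :
  child (node (a.1, nseq n j0 ++ a.2)) (node (a.1, nseq n.+1 j0 ++ a.2)).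
Proof. exact: eqxx. Qed.

Definition extend (a : 'I_k * seq 'I_d) : ray := ray_through (extend_chain a).

Lemma extendP a : shadow (node a) (extend a).
Proof. by case: a => i s; exact: (ray_throughP (extend_chain (i, s)) 0). Qed.

Lemma shadow_ray x n : shadow (x n) x.
Proof. by rewrite /shadow /= /on_ray depth_ray. Qed.

Lemma ray_node x n : exists2 a : 'I_k * seq 'I_d, x n.+1 = node a & size a.2 = n.
Proof.
have := depth_ray x n.+1; case: (x n.+1) => [a|//].
by exists a => //; case: a H => i s /= [].
Qed.

(** If g fixes every ray through v and v is deep, then the image of v lies on two
    rays that separate just below v, so it is at most as deep as v; applied to
    g^-1 as well, this shows that g fixes v. *)
Lemma act_faithful (j1 : 'I_d) (g : neretin) : j0 != j1 ->
  act g =1 id -> g = 1.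
Proof.
move=> j01.
have shallow p : act (neretin_class p) =1 id -> exists N, forall v,
    N <= depth v -> shadow v `<=` shadow (almost_map p v) /\
      (v != root -> depth (almost_map p v) <= depth v).
  move=> p1; have [N NP] := act_class p; exists N => v Nv.
  have vP x : on_ray x v -> on_ray x (almost_map p v).
    by move=> xv; have := NP x _ Nv; rewrite p1 xv.
  split=> //; case: v Nv vP => // a Na aP _; rewrite leqNgt; apply/negP => lt_a.
  pose x j := extend (kid a j).
  have xE j : x j (depth (node a)).+1 =
      ancestor (depth (node a)).+1 (almost_map p (node a)).
    by apply: on_rayE lt_a; apply: aP; apply: shadow_kid (extendP (kid a j)).
  have : node (kid a j0) = node (kid a j1).
    have := extendP (kid a j0); have := extendP (kid a j1).
    rewrite /shadow/= /on_ray.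
    have -> : depth (node (kid a j0)) = (depth (node a)).+1 by case: (a).
    have -> : depth (node (kid a j1)) = (depth (node a)).+1 by case: (a).
    by rewrite -!/(x _) !xE => <- <-.
  by move=> [] /eqP; apply/negP.
rewrite -[g]neretin_reprK; move: (neretin_repr g) => p p1.
have q1 : act (neretin_class (almost_inv p)) =1 id.
  move=> x; have -> : neretin_class (almost_inv p) = (neretin_class p)^-1.
    apply: (mulIg (neretin_class p)); rewrite mulVg.
    rewrite -[LHS]/(neretin_mul _ _) neretin_mulE; apply/neretin_classP.
    have [N NP] := finite_almost_dom p; exists N => v /NP vp.
    exact: almost_mapK.
  by rewrite -{2}(actK (neretin_class p) x) p1.
have [N NP] := shallow _ p1; have [M MP] := shallow _ q1.
have [m mP] := almost_map_proper p M; have [l lP] := finite_almost_dom p.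
apply/neretin_classP; exists (maxn N (maxn m l)) => v.
rewrite !gtn_max => /and3P[Nv mv lv].
have vr : v != root by apply: contraTneq lv => ->.
have pvr : almost_map p v != root by apply: contraTneq (mP _ mv) => ->.
have [vsh le1] := NP v (ltnW Nv).
have [_] := MP _ (ltnW (mP _ mv)); rewrite almost_mapK; last exact: lP.
move=> /(_ pvr) le2.
case: v vr vsh le1 le2 {Nv mv lv pvr} => // a ar vsh /(_ ar) le1 le2.
apply: (@shadow_depth _ _ (extend a)); last exact: extendP.
  by apply/eqP; rewrite eqn_leq le1 le2.
exact/vsh/extendP.
Qed.

End Extension.

End Clopen.

(** * Exchanging and compressing balls *)

Section Swap.
Variables d k : nat.
Local Notation vertex := (vertex d k).
Local Notation root := (Defs.root d k).
Local Notation neretin := (neretin d k).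
Local Notation ray := (ray d k).
Local Notation node := (@node d k).
Local Notation shadow := (@shadow d k).

Definition graft (t : seq 'I_d) (a : 'I_k * seq 'I_d) : vertex :=
  Some (a.1, t ++ a.2).

Definition below (a : 'I_k * seq 'I_d) (v : vertex) : bool :=
  if v is Some (i, s) then (i == a.1) && suffix a.2 s else false.

Lemma belowP a v : reflect (exists t, v = graft t a) (below a v).
Proof.
apply: (iffP idP); last by move=> [t ->]; rewrite /= eqxx suffix_suffix.
by case: v => // -[i s] /= /andP[/eqP -> /suffixP[t ->]]; exists t.
Qed.

Lemma below_graft t a : below a (graft t a).
Proof. by apply/belowP; exists t. Qed.

Lemma graft_cons j t a : child (graft t a) (graft (j :: t) a).
Proof. exact: eqxx. Qed.

Lemma below_child a u v : child u v -> below a u -> below a v.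
Proof.
move=> uv /belowP[t uE]; move: uv; rewrite uE; case: v => [[i [|j s]]|]//=.
by move=> /eqP[<- <-]; rewrite eqxx -cat_cons suffix_suffix.
Qed.

Lemma below_parent a u v : child u v -> below a v -> v <> node a -> below a u.
Proof.
move=> uv /belowP[[|j t] vE] va; first by case: va; rewrite vE; case: a {vE}.
rewrite vE in uv; rewrite (parent_uniq uv (graft_cons j t a)).
exact: below_graft.
Qed.

Lemma below_shadow a v : below a v -> shadow v `<=` shadow (node a).
Proof.
move=> /belowP[t ->]; elim: t => [|j t IH]; first by case: a => i s x.
by apply: subset_trans IH; apply/shadow_child/graft_cons.
Qed.

Lemma below_total a b v : below a v -> below b v ->
  below a (node b) \/ below b (node a).
Proof.
move=> /belowP[t ->] /belowP[t' [ab tt]].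
wlog le_ab : a b t t' ab tt / size a.2 <= size b.2.
  move=> H; case: (leqP (size a.2) (size b.2)) => [|/ltnW] le.
    exact: H tt le.
  by apply/or_comm; apply: (H b a t' t) le.
left; case: b ab tt le_ab => i b /= <- tt le_ab; rewrite eqxx.
have le_t : size t' <= size t.
  by rewrite -(leq_add2r (size b)) -size_cat -tt size_cat leq_add2l.
apply/suffixP; exists (drop (size t') t).
move/(congr1 (drop (size t'))): tt; rewrite [X in _ = X]drop_size_cat// drop_cat.
case: ltnP => [_ -> //|ge_t].
have -> : size t' = size t by apply/eqP; rewrite eqn_leq le_t.
by rewrite subnn drop0 drop_size.
Qed.

Lemma ray_below a (x : ray) n : below a (x n) -> shadow (node a) x.
Proof. by move=> /below_shadow; apply; exact: shadow_ray. Qed.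

Lemma shadow_below a (x : ray) n : shadow (node a) x -> depth (node a) <= n ->
  below a (x n).
Proof.
move=> xa; elim: n => [|n IH]; first by case: (a).
rewrite leq_eqVlt => /orP[/eqP <-|/IH]; last exact/below_child/ray_child.
by rewrite xa; case: (a) => i s; exact: (below_graft [::] (i, s)).
Qed.

(** The strict ancestors of a: the exchange of the subtrees below a and b is an
    isomorphism outside the strict ancestors of a and b. *)
Definition stem (a : 'I_k * seq 'I_d) : set vertex :=
  [set u | u = root \/ exists i s t j, u = Some (i, s) /\ a = (i, t ++ j :: s)].

Lemma stem_below a b v : below a v -> stem b v -> below a (node b).
Proof.
move=> /belowP[t ->] [//|[i [s [t' [j [[<- <-] ->]]]]]].
by rewrite /= eqxx -cat_cons catA suffix_suffix.
Qed.

Lemma stemN a v : below a v -> ~ stem a v.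
Proof.
move=> /belowP[t ->] [//|[i [s [t' [j [[<- <-] aE]]]]]].
have := congr1 (fun z => size z.2) aE.
rewrite /= size_cat /= size_cat => /eqP; apply/negP.
by rewrite neq_ltn addnS ltnS addnA leq_addl.
Qed.

Lemma child_stem a u : child u (node a) -> stem a u.
Proof.
case: a => i [|j s] /= /eqP ->; [by left | right].
by exists i, s, [::], j.
Qed.

Lemma stem_child a u v : child u v -> stem a v -> stem a u.
Proof.
move=> uv [vr|[i [s [t [j [vE ->]]]]]]; first by rewrite vr in uv.
move: uv; rewrite vE; case: s {vE} => [|j' s] /= /eqP ->; [by left|right].
by exists i, s, (rcons t j), j'; rewrite cat_rcons.
Qed.

Lemma stem_finite a : finite_set (stem a).
Proof.
apply: (@sub_finite_set _ _ (Defs.ball (size a.2))); last exact: finite_ball.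
move=> v [->//|[i [s [t [j [-> ->]]]]]].
by rewrite /Defs.ball /= size_cat /= leq_addl.
Qed.

Section SwapElement.
Variables a b : 'I_k * seq 'I_d.
Hypothesis ab : ~~ below a (node b).
Hypothesis ba : ~~ below b (node a).

Definition swap (v : vertex) : vertex :=
  if v is Some (i, s) then
    if below a v then graft (take (size s - size a.2) s) b
    else if below b v then graft (take (size s - size b.2) s) a
    else v
  else v.

Lemma below_disj v : below a v -> ~~ below b v.
Proof.
move=> va; apply/negP => vb.
by case: (below_total va vb); apply/negP.
Qed.

Lemma swap_l t : swap (graft t a) = graft t b.
Proof.
have := below_graft t a; rewrite /swap /= => ->.
by rewrite size_cat addnK take_size_cat.
Qed.

Lemma swap_r t : swap (graft t b) = graft t a.
Proof.
have tb := below_graft t b; rewrite /swap.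
case: ifP => [/below_disj|_]; first by rewrite tb.
by rewrite /graft in tb; rewrite /graft tb size_cat addnK take_size_cat.
Qed.

Lemma swap_out v : ~~ below a v -> ~~ below b v -> swap v = v.
Proof. by case: v => // -[i s] va vb; rewrite /swap (negbTE va) (negbTE vb). Qed.

Lemma swapK : involutive swap.
Proof.
move=> v; have [/belowP[t ->]|va] := boolP (below a v).
  by rewrite swap_l swap_r.
have [/belowP[t ->]|vb] := boolP (below b v); first by rewrite swap_r swap_l.
by rewrite !swap_out.
Qed.

Let A : set vertex := stem a `|` stem b.

Lemma swap_subtree : finite_subtree A.
Proof.
split; first by rewrite finite_setU; split; exact: stem_finite.
  by left; left.
by move=> u v uv [] /(stem_child uv); [left|right].
Qed.

Lemma swap_stem v : ~ A v -> ~ A (swap v).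
Proof.
have aA t : ~ A (graft t a).
  case; first exact/stemN/below_graft.
  by move=> /(stem_below (below_graft t a)); apply/negP.
have bA t : ~ A (graft t b).
  case; last exact/stemN/below_graft.
  by move=> /(stem_below (below_graft t b)); apply/negP.
have [/belowP[t ->]|va] := boolP (below a v); first by rewrite swap_l.
have [/belowP[t ->]|vb] := boolP (below b v); first by rewrite swap_r.
by rewrite swap_out.
Qed.

Lemma swap_child u v : ~ A u -> child u v -> child (swap u) (swap v).
Proof.
move=> uA uv; have [/belowP[t uE]|ua] := boolP (below a u).
  move: uv; rewrite uE; case: v => [[i [|j s]]|]// uv.
  move: (uv) => /eqP[<- <-]; rewrite -cat_cons.
  by rewrite -[Some _]/(graft (j :: t) a) !swap_l; exact: graft_cons.
have [/belowP[t uE]|ub] := boolP (below b u).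
  move: uv; rewrite uE; case: v => [[i [|j s]]|]// uv.
  move: (uv) => /eqP[<- <-]; rewrite -cat_cons.
  by rewrite -[Some _]/(graft (j :: t) b) !swap_r; exact: graft_cons.
rewrite !swap_out//; apply/negP.
  move=> /(below_parent uv) H; apply: uA; left; apply: child_stem.
  have [<-//|va] := pselect (v = node a).
  by case/negP: ua; exact: H.
move=> /(below_parent uv) H; apply: uA; right; apply: child_stem.
have [<-//|vb] := pselect (v = node b).
by case/negP: ub; exact: H.
Qed.

Lemma swap_iso : forest_iso A A swap.
Proof.
have adj u v : ~ A u -> ~ A v -> adjacent u v -> adjacent (swap u) (swap v).
  move=> uA vA /orP[uv|vu]; rewrite /adjacent.
    by rewrite (swap_child uA uv).
  by rewrite (swap_child vA vu) orbT.
split; first split=> [|u v _ _ /(can_inj swapK)//|v vA].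
- exact: swap_stem.
- by exists (swap v); [exact: swap_stem|exact: swapK].
move=> u v uA vA; apply/idP/idP; last exact: adj.
by move/(adj _ _ (swap_stem uA) (swap_stem vA)); rewrite !swapK.
Qed.

Definition swap_neretin : neretin :=
  neretin_class (mk_almost_aut swap_subtree swap_subtree swap_iso).

Lemma act_swap_l (x : ray) :
  shadow (node a) x -> shadow (node b) (act swap_neretin x).
Proof.
move=> xa; have [N NP] :=
  act_class (mk_almost_aut swap_subtree swap_subtree swap_iso).
have := NP x (maxn N (depth (node a))); rewrite leq_maxl => /(_ isT) /=.
have /belowP[t ->] := shadow_below xa (leq_maxr N (depth (node a))).
by rewrite swap_l => ?; apply: (below_shadow (below_graft t b)).
Qed.

Lemma act_swap_out (x : ray) : ~ shadow (node a) x -> ~ shadow (node b) x ->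
  act swap_neretin x = x.
Proof.
move=> xa xb; apply: (@act_unique _ _ _ x x 0) => n _ /=.
rewrite swap_out ?shadow_ray//; first exact: shadow_ray.
  by apply/negP => /ray_below.
by apply/negP => /ray_below.
Qed.

End SwapElement.

Variables j0 j1 : 'I_d.
Hypothesis j01 : j0 != j1.

Lemma swap_shadows a b : shadow (node a) `&` shadow (node b) = set0 ->
  exists g : neretin,
    (forall x, shadow (node a) x -> shadow (node b) (act g x)) /\
    (forall x, ~ shadow (node a) x -> ~ shadow (node b) x -> act g x = x).
Proof.
move=> ab0.
have ab : ~~ below a (node b).
  apply/negP => /below_shadow /(_ _ (extendP j0 b)) bx.
  move: ab0; rewrite -subset0 => /(_ (extend j0 b)); apply.
  by split=> //; exact: extendP.
have ba : ~~ below b (node a).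
  apply/negP => /below_shadow /(_ _ (extendP j0 a)) bx.
  move: ab0; rewrite -subset0 => /(_ (extend j0 a)); apply.
  by split=> //; exact: extendP.
exists (swap_neretin ab ba); split=> x; first exact: act_swap_l.
exact: act_swap_out.
Qed.

(** Two disjoint balls inside the target are available at each step: one receives
    the next ball by an exchange, the other receives all the remaining ones. *)
Lemma compress_shadows n (ws : seq ('I_k * seq 'I_d)) v : uniq ws ->
  (forall w, w \in ws -> depth (node w) = n) ->
  (forall w, w \in ws -> shadow (node w) `&` shadow (node v) = set0) ->
  exists g : neretin,
    (forall x, (forall w, w \in ws -> ~ shadow (node w) x) ->
       ~ shadow (node v) x -> act g x = x) /\
    (forall w x, w \in ws -> shadow (node w) x -> shadow (node v) (act g x)).
Proof.
elim: ws v => [|w ws IH] v.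
  by move=> _ _ _; exists 1; split=> // x; rewrite act1.
rewrite cons_uniq => /andP[w_ws ws_uniq] wn wv.
have sub0 := @shadow_kid d k v j0; have sub1 := @shadow_kid d k v j1.
have kids := @shadow_kids d k v _ _ j01.
have wv' u : u \in w :: ws -> forall x, shadow (node u) x -> ~ shadow (node v) x.
  by move=> /wv + x xu xv; rewrite -subset0 => /(_ x); apply.
have ww' u : u \in ws -> forall x, shadow (node u) x -> ~ shadow (node w) x.
  move=> uws x xu xw; case/negP: w_ws.
  have uw : depth (node u) = depth (node w) by rewrite !wn ?inE ?eqxx ?uws ?orbT.
  by have [<-] := shadow_depth uw xu xw.
have [||//|g1 [g1out g1in]] := IH (kid v j0).
- by [].
- by move=> u uws; apply: wn; rewrite inE uws orbT.
- move=> u uws; rewrite -subset0 => x [xu /sub0].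
  by apply: wv' xu; rewrite inE uws orbT.
have [|s [sin sout]] := @swap_shadows w (kid v j1).
  by rewrite -subset0 => x [xw /sub1]; apply: wv' xw; rewrite inE eqxx.
exists (s * g1); split=> [x xws xv|u x].
  rewrite actM g1out; first last.
  - by move=> /sub0.
  - by move=> u uws; apply: xws; rewrite inE uws orbT.
  by apply: sout; [apply: xws; rewrite inE eqxx | move=> /sub1].
rewrite inE actM => /orP[/eqP -> xw|uws xu].
  rewrite g1out; first exact/sub1/sin.
    by move=> u' uws /(ww' _ uws).
  by move=> /sub0; apply: wv' xw; rewrite inE eqxx.
have gx := g1in _ _ uws xu; rewrite sout; first exact: sub0.
- by move=> /wv'; apply; [rewrite inE eqxx|exact: sub0].
- by move=> gx1; move: kids; rewrite -subset0 => /(_ (act g1 x)); apply.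
Qed.

(** F minus the ball below a is a union of finitely many balls of one depth, all
    disjoint from the ball below v. *)
Lemma compress (F : set ray) a v : ray_clopen F -> shadow (node a) `<=` F ->
  shadow (node v) `<=` shadow (node a) ->
  exists g : neretin, (forall x, ~ F x -> act g x = x) /\
    (forall x, F x -> ~ shadow (node a) x -> shadow (node v) (act g x)).
Proof.
move=> cF aF va.
have [n nW] : ray_clopen (F `&` ~` shadow (node a)).
  by apply: ray_clopenI => //; apply: ray_clopenC; exact: ray_clopen_shadow.
set W := F `&` _ in nW.
pose f (z : 'I_k * n.-tuple 'I_d) : 'I_k * seq 'I_d := (z.1, val z.2).
have f_inj : injective f by move=> [i s] [i' s'] [-> /val_inj ->].
pose ws := [seq w <- [seq f z | z <- enum {: 'I_k * n.-tuple 'I_d}] |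
  `[< shadow (node w) `<=` W >]].
have wsW w : w \in ws -> shadow (node w) `<=` W.
  by rewrite mem_filter => /andP[/asboolP].
have [|w||g [gout gin]] := @compress_shadows n.+1 ws v.
- by rewrite filter_uniq// map_inj_uniq// enum_uniq.
- by rewrite mem_filter => /andP[_ /mapP[z _ ->]] /=; rewrite size_tuple.
- move=> w /wsW wW; rewrite -subset0 => x [/wW[_ xa] /va]; exact: xa.
exists g; split=> [x xF|x xF xa].
  apply: gout => [w /wsW wW /wW[]//|/va /aF//].
have [w xw sw] := ray_node x n.
have xw' : shadow (node w) x by rewrite -[node w]xw; exact: shadow_ray.
apply: gin xw'; rewrite mem_filter; apply/andP; split.
  apply/asboolP => y; rewrite /shadow/= /on_ray -[node w]xw depth_ray => yx.
  by apply: (determinedS (leqnSn n) nW) (esym yx) _; split.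
apply/mapP; have sw' : size w.2 == n by apply/eqP.
exists (w.1, Tuple sw'); first by rewrite mem_enum.
exact: surjective_pairing.
Qed.

End Swap.

(** * The compact space of precedences *)

Section Subbase.
Variables (T : topologicalType) (D : set (set T)).
Hypothesis openE : @open T =
  [set \bigcup_(A in E) A | E in subset^~ (finI_from D id)].

Lemma open_subbase A : D A -> open A.
Proof.
move=> DA; rewrite openE; exists [set A]; last by rewrite bigcup_set1.
by move=> _ ->; exact: finI_from1.
Qed.

Lemma cvg_subbase (F : set_system T) t : Filter F ->
  (forall A, D A -> A t -> F A) -> F --> t.
Proof.
move=> FF FD U; rewrite nbhsE => -[V [oV Vt] VU].
move: oV; rewrite openE => -[E EI EV].
move: Vt; rewrite -EV => -[C EC tC]; have [B BD BC] := EI _ EC.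
rewrite nbhs_filterE; apply: (@filterS _ F _ C).
  by apply: subset_trans VU; rewrite -EV => x Cx; exists C.
rewrite -BC; apply: filter_bigI => A AB; apply: FD.
  by have := BD _ AB; rewrite inE.
by move: tC; rewrite -BC => /(_ _ AB).
Qed.

End Subbase.

Section Precedence.
Variables d k : nat.
Local Notation neretin := (neretin d k).
Local Notation ray := (ray d k).
Local Notation ray_clopen := (@ray_clopen d k).

(** [prec_clopen] confines the relation to sets with open stabilizers, so that the
    action is continuous. *)
Record precedence := Precedence {
  prec :> set ray -> set ray -> Prop;
  prec_clopen : forall U V, prec U V -> ray_clopen U /\ ray_clopen V;
  prec_asym : forall U V, prec U V -> ~ prec V U;
  prec_mono : forall U U' V V', ray_clopen U' -> ray_clopen V' ->
    U `<=` U' -> V' `<=` V -> prec U V -> prec U' V';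
  prec_total : forall U V, ray_clopen U -> ray_clopen V ->
    U `&` V = set0 -> U `|` V !=set0 -> prec U V \/ prec V U }.

Lemma prec_eq (y z : precedence) : (forall U V, y U V <-> z U V) -> y = z.
Proof.
case: y z => [r r1 r2 r3 r4] [s s1 s2 s3 s4] /= rs.
have E : r = s by apply/funext => U; apply/funext => V; exact/propext.
by subst s; congr Precedence; exact: Prop_irrelevance.
Qed.

HB.instance Definition _ := gen_eqMixin precedence.
HB.instance Definition _ := gen_choiceMixin precedence.

Definition before (U V : set ray) : set precedence := [set y | y U V].

Definition prec_subbase : set (set precedence) :=
  [set A | exists U V, A = before U V \/ A = ~` before U V].

HB.instance Definition _ := @isSubBaseTopological.Build precedence
  (set precedence) prec_subbase id.

Lemma prec_openE : @open precedence =
  [set \bigcup_(A in E) A | E in subset^~ (finI_from prec_subbase id)].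
Proof. by []. Qed.

Lemma open_before U V : open (before U V).
Proof. by apply: (open_subbase prec_openE); exists U, V; left. Qed.

Lemma open_beforeC U V : open (~` before U V).
Proof. by apply: (open_subbase prec_openE); exists U, V; right. Qed.

Lemma precedence_hausdorff : hausdorff_space precedence.
Proof.
rewrite open_hausdorff => y z yz.
have [U [V UV]] : exists U V, ~ (y U V <-> z U V).
  apply: contrapT => yz'; case/eqP: yz; apply: prec_eq => U V.
  by apply: contrapT => UV; apply: yz'; exists U, V.
have [oB oC] := (open_before U V, open_beforeC U V).
have [yUV|yUV] := pselect (y U V).
  exists (before U V, ~` before U V); last by split=> //; rewrite setICr.
  by rewrite !inE; split=> // zUV; apply: UV.
exists (~` before U V, before U V); last by split=> //; rewrite setICl.
by rewrite !inE; split=> //; apply: contrapT => zUV; apply: UV.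
Qed.

(** The defining conditions only involve finitely many values of the relation, so
    they pass to limits along ultrafilters. *)
Lemma precedence_compact : compact [set: precedence].
Proof.
rewrite compact_ultra => F FU _.
pose r U V := F (before U V).
have ex A : F A -> A !=set0 by exact: filter_ex.
have r1 U V : r U V -> ray_clopen U /\ ray_clopen V.
  by move=> /ex[y]; exact: prec_clopen.
have r2 U V : r U V -> ~ r V U.
  move=> rUV rVU; have FI : F (before U V `&` before V U) by exact: filterI.
  by have [y [/prec_asym]] := ex _ FI.
have r3 U U' V V' : ray_clopen U' -> ray_clopen V' ->
    U `<=` U' -> V' `<=` V -> r U V -> r U' V'.
  move=> cU cV UU VV; apply: (@filterS _ F _ (before U V) (before U' V')) => y.
  exact: prec_mono.
have r4 U V : ray_clopen U -> ray_clopen V ->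
    U `&` V = set0 -> U `|` V !=set0 -> r U V \/ r V U.
  move=> cU cV UV0 UV.
  have [|FN] := in_ultra_setVsetC (before U V) FU; first by left.
  by right; apply: filterS FN => y yUV; have [] := prec_total y cU cV UV0 UV.
exists (Precedence r1 r2 r3 r4); split=> //=.
apply: (cvg_subbase prec_openE) => A [U [V [->//|->]]].
by move=> /= nF; have [] := in_ultra_setVsetC (before U V) FU.
Qed.

Lemma prec_act_total (g : neretin) (y : precedence) U V :
  ray_clopen U -> ray_clopen V -> U `&` V = set0 -> U `|` V !=set0 ->
  (ray_clopen U /\ ray_clopen V) /\ y (act g @^-1` U) (act g @^-1` V) \/
  (ray_clopen V /\ ray_clopen U) /\ y (act g @^-1` V) (act g @^-1` U).
Proof.
move=> cU cV UV0 UV.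
have : y (act g @^-1` U) (act g @^-1` V) \/ y (act g @^-1` V) (act g @^-1` U).
  apply: prec_total; [exact: ray_clopen_act|exact: ray_clopen_act|..].
    by rewrite -preimage_setI UV0 preimage_set0.
  have [x xUV] := UV; exists (act g^-1 x).
  by rewrite -preimage_setU /preimage/= actVK.
by case; [left|right].
Qed.

Definition prec_act (g : neretin) (y : precedence) : precedence.
Proof.
apply: (@Precedence (fun U V => (ray_clopen U /\ ray_clopen V) /\
  y (act g @^-1` U) (act g @^-1` V))).
- by move=> U V [].
- by move=> U V [_ +] [_]; exact: prec_asym.
- move=> U U' V V' cU cV UU VV [_ yUV]; split=> //.
  by apply: prec_mono yUV; [exact: ray_clopen_act..|move=> x /UU|move=> x /VV].
- by move=> U V; exact: prec_act_total.
Defined.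

Lemma prec_actE g y U V : ray_clopen U -> ray_clopen V ->
  prec_act g y U V <-> y (act g @^-1` U) (act g @^-1` V).
Proof. by move=> cU cV; split=> [[]|]. Qed.

Lemma prec_act1 y : prec_act 1 y = y.
Proof.
have id1 : act 1 = id :> (ray -> ray) by apply/funext => x; exact: act1.
apply: prec_eq => U V; rewrite /= id1; split=> [[]//|yUV].
by split=> //; exact: prec_clopen yUV.
Qed.

Lemma prec_actM g h y : prec_act (g * h) y = prec_act g (prec_act h y).
Proof.
have gh : act (g * h) = act g \o act h :> (ray -> ray).
  by apply/funext => x; exact: actM.
apply: prec_eq => U V; rewrite /= gh !comp_preimage; split.
  by move=> [[cU cV] yUV]; split=> //; split=> //; split; exact: ray_clopen_act.
by move=> [[cU cV] [_ yUV]].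
Qed.

Lemma prec_act_continuous :
  continuous (fun p : neretin * precedence => prec_act p.1 p.2).
Proof.
move=> [g y]; apply: (cvg_subbase prec_openE) => A /= [U [V AE]] gyA.
have [[cU cV]|nc] := pselect (ray_clopen U /\ ray_clopen V); last first.
  exists (setT, setT); first by split; exact: filterT.
  move=> [h z] _ /=; move: gyA; case: AE => -> /=.
    by move=> [].
  by move=> _ [].
have gU := near_act g cU; have gV := near_act g cV.
set B := [set h : neretin | act h @^-1` U = act g @^-1` U] in gU.
set C := [set h : neretin | act h @^-1` V = act g @^-1` V] in gV.
have nbC (W : set precedence) : open W -> W y -> nbhs (g, y) ((B `&` C) `*` W).
  move=> oW Wy; exists (B `&` C, W) => //; split; first exact: filterI.
  exact: open_nbhs_nbhs.
case: AE gyA => -> /= gyA.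
  apply: filterS (nbC _ (open_before (act g @^-1` U) (act g @^-1` V)) gyA.2).
  by move=> [h z] /= [[hU hV]]; rewrite /before /= hU hV.
have nyUV : ~ y (act g @^-1` U) (act g @^-1` V).
  by move=> yUV; apply: gyA.
apply: filterS (nbC _ (open_beforeC (act g @^-1` U) (act g @^-1` V)) nyUV).
by move=> [h z] /= [[hU hV]] H [_]; rewrite hU hV.
Qed.

End Precedence.

(** * A free point: the order of a dense sequence *)

Section Dense.
Variables (d k : nat) (i0 : 'I_k) (j0 : 'I_d).
Local Notation ray := (ray d k).

Definition dense_ray (n : nat) : ray :=
  extend j0 (odflt (i0, [::]) (unpickle n)).

Lemma dense_rayP (x : ray) n : exists i, dense_ray i n = x n.
Proof.
have [a xa _] := ray_node x n; exists (pickle a).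
have := extendP j0 a; rewrite -xa /shadow/= /on_ray depth_ray => ax.
by rewrite /dense_ray pickleK/= -(ancestor_ray x (leqnSn n)) -ax ancestor_ray.
Qed.

Definition dense_before (U V : set ray) := (ray_clopen U /\ ray_clopen V) /\
  exists2 i, U (dense_ray i) & forall j, j <= i -> ~ V (dense_ray j).

Lemma dense_before_asym U V : dense_before U V -> ~ dense_before V U.
Proof.
move=> [_ [i Ui Vi]] [_ [j Vj Uj]]; case: (leqP i j) => [/Uj//|/ltnW ji].
exact: Vi ji Vj.
Qed.

Lemma dense_before_mono U U' V V' : ray_clopen U' -> ray_clopen V' ->
  U `<=` U' -> V' `<=` V -> dense_before U V -> dense_before U' V'.
Proof.
move=> cU cV UU VV [_ [i Ui Vi]]; split=> //; exists i; first exact: UU.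
by move=> j /Vi nV /VV.
Qed.

Lemma dense_before_total U V : ray_clopen U -> ray_clopen V ->
  U `&` V = set0 -> U `|` V !=set0 -> dense_before U V \/ dense_before V U.
Proof.
move=> cU cV; rewrite -subset0 => UV0 [x xUV].
have [n nU] := cU; have [m mV] := cV; pose l := maxn n m.
have [i ix] := dense_rayP x l.
have ex_i : exists i, `[< (U `|` V) (dense_ray i) >].
  exists i; apply/asboolP; case: xUV => xU; [left|right].
    by apply: (determinedS (leq_maxl n m) nU) xU; rewrite ix.
  by apply: (determinedS (leq_maxr n m) mV) xU; rewrite ix.
case: (ex_minnP ex_i) => {ix ex_i} {}i /asboolP UVi imin.
have lei j : (U `|` V) (dense_ray j) -> i <= j by move=> Uj; exact/imin/asboolP.
case: UVi => Di; [left|right]; split=> //; exists i => // j ji Dj.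
- have ij : i = j by apply/eqP; rewrite eqn_leq ji lei//; right.
  by apply: (UV0 (dense_ray i)); split=> //; rewrite ij.
- have ij : i = j by apply/eqP; rewrite eqn_leq ji lei//; left.
  by apply: (UV0 (dense_ray i)); split=> //; rewrite ij.
Qed.

(** The free point; it also serves as a base point of the space. *)
Definition dense_precedence : precedence d k :=
  @Precedence d k dense_before (fun _ _ => @proj1 _ _) dense_before_asym
    dense_before_mono dense_before_total.

(** A witness that c does not preserve [dense_before]: V comes before both c V and
    c^-1 V.  The bounds by N make it visible on finitely many balls. *)
Definition displaces N (c : neretin d k) := exists V : set ray,
  [/\ determined N V, determined N (act c @^-1` V),
      determined N (act c^-1 @^-1` V) &
  exists2 i, i < N & [/\ V (dense_ray i),
    (forall j, j < i -> ~ V (dense_ray j)),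
    (forall j, j <= i -> ~ V (act c (dense_ray j))) &
    (forall j, j <= i -> ~ V (act c^-1 (dense_ray j)))]].

Lemma shadow_rayE (x z : ray) n : shadow (x n) z <-> z n = x n.
Proof. by rewrite /shadow/= /on_ray depth_ray. Qed.

Lemma ray_neqS (x y : ray) n m : n <= m -> x n <> y n -> x m <> y m.
Proof.
move=> nm xy xym; apply: xy.
by rewrite -(ancestor_ray x nm) xym ancestor_ray. Qed.

Lemma ray_neqP (x y : ray) : x <> y -> exists n, x n <> y n.
Proof.
move=> xy; apply: contrapT => H; apply: xy; apply: ray_eq => n.
by apply: contrapT => xyn; apply: H; exists n.
Qed.

Lemma ray_separate (x : ray) (f : nat -> ray) n :
  (forall j, j < n -> f j <> x) -> exists m, forall j, j < n -> f j m <> x m.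
Proof.
elim: n => [|n IH] fx; first by exists 0.
have [j jn|m mP] := IH; first by apply: fx; exact: ltnW.
have [l lP] := ray_neqP (fx n (leqnn _)).
exists (maxn m l) => j; rewrite ltnS leq_eqVlt => /orP[/eqP ->|/mP].
  exact: ray_neqS (leq_maxr _ _) lP.
exact: ray_neqS (leq_maxl _ _).
Qed.

(** The first ray x_i that c moves is also the first one that c^-1 moves, so a small
    ball V around x_i avoids c x_i, c^-1 x_i and the rays x_j with j < i, which c
    fixes. *)
Lemma near_displaces (j1 : 'I_d) (j01 : j0 != j1) (c : neretin d k) : c <> 1 ->
  \forall c' \near c & N \near \oo, displaces N c'.
Proof.
move=> c1.
have [x cx] : exists x, act c x <> x.
  apply: contrapT => H; apply: c1; apply: (act_faithful j01) => x.
  by apply: contrapT => cx; apply: H; exists x.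
have [n cxn] := ray_neqP cx; have [m mP] := act_uniform c n.
have [i ix] := dense_rayP x (maxn n m).
have ex_i : exists i, `[< act c (dense_ray i) <> dense_ray i >].
  exists i; apply/asboolP => /(congr1 (fun z : ray => z n)).
  rewrite (mP _ x); last first.
    rewrite -(ancestor_ray (dense_ray i) (leq_maxr n m)) ix.
    by rewrite ancestor_ray// leq_maxr.
  rewrite -(ancestor_ray (dense_ray i) (leq_maxl n m)) ix.
  by rewrite ancestor_ray// leq_maxl.
case: (ex_minnP ex_i) => {ix ex_i} {}i /asboolP ci imin.
have fixj j : j < i -> act c (dense_ray j) = dense_ray j.
  move=> ji; apply: contrapT => /asboolP/imin.
  by rewrite leqNgt ji.
have fixVj j : j < i -> act c^-1 (dense_ray j) = dense_ray j.
  by move=> /fixj {1}<-; rewrite actK.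
have cVi : act c^-1 (dense_ray i) <> dense_ray i.
  by move=> cVi; apply: ci; rewrite -{1}cVi actVK.
have [|M1 M1P] := @ray_separate (dense_ray i) dense_ray i.
  by move=> j ji ij; apply: ci; rewrite -ij fixj.
have [M2 M2P] := ray_neqP ci; have [M3 M3P] := ray_neqP cVi.
pose M := maxn M1 (maxn M2 M3).
pose V := shadow (dense_ray i M).
have VE z : V z <-> z M = dense_ray i M by exact: shadow_rayE.
have cV : ray_clopen V by exact: ray_clopen_shadow.
have Vj j : j < i -> ~ V (dense_ray j).
  by move=> /M1P ji /VE; apply: ray_neqS ji; exact: leq_maxl.
have Vci : ~ V (act c (dense_ray i)).
  by move=> /VE; apply: ray_neqS M2P; rewrite /M !leq_max leqnn orbT.
have VcVi : ~ V (act c^-1 (dense_ray i)).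
  by move=> /VE; apply: ray_neqS M3P; rewrite /M !leq_max leqnn !orbT.
have [n1 n1P] := cV; have [n2 n2P] := ray_clopen_act c cV.
have [n3 n3P] := ray_clopen_act c^-1 cV.
have nVc : \forall c' \near c, act c'^-1 @^-1` V = act c^-1 @^-1` V.
  exact: (@invg_continuous _ c _ (near_act c^-1 cV)).
exists ([set c' | act c' @^-1` V = act c @^-1` V /\
    act c'^-1 @^-1` V = act c^-1 @^-1` V],
  [set N | maxn n1 (maxn n2 (maxn n3 i.+1)) <= N]).
  split; first exact: filterI (near_act c cV) nVc.
  exact: nbhs_infty_ge.
move=> [c' N] /= [[c'V c'VV]]; rewrite !geq_max => /and4P[N1 N2 N3 iN].
exists V; split.
- exact: determinedS n1P.
- by rewrite c'V; exact: determinedS n2P.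
- by rewrite c'VV; exact: determinedS n3P.
exists i => //; split=> //; first exact/VE.
- move=> j; rewrite leq_eqVlt => Dj cj.
  have {cj} : (act c @^-1` V) (dense_ray j) by rewrite -c'V.
  by case/orP: Dj => [/eqP -> //|ji]; rewrite /= fixj//; exact: Vj.
- move=> j; rewrite leq_eqVlt => Dj cj.
  have {cj} : (act c^-1 @^-1` V) (dense_ray j) by rewrite -c'VV.
  by case/orP: Dj => [/eqP -> //|ji]; rewrite /= fixVj//; exact: Vj.
Qed.

End Dense.

(** * Steering a measure towards the free point *)

Definition pointed_precedence d k (y : precedence d k) : ptopologicalType :=
  HB.pack (precedence d k) (isPointed.Build (precedence d k) y).

Section Likely.
Variables (R : realType) (d k : nat) (y0 : precedence d k).
Local Notation neretin := (neretin d k).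
Local Notation ray := (ray d k).
Local Notation Y := (borel (pointed_precedence y0)).
Variable mu : probability Y R.

Lemma measurable_before U V : measurable (before U V : set Y).
Proof. by apply: sub_sigma_algebra; exact: open_before. Qed.
Local Hint Resolve measurable_before : core.

Definition chance (U V : set ray) : R := fine (mu (before U V)).

Lemma chanceE U V : mu (before U V) = (chance U V)%:E.
Proof. by rewrite fineK// fin_num_measure. Qed.

Lemma chance_mono U U' V V' : ray_clopen U' -> ray_clopen V' ->
  U `<=` U' -> V' `<=` V -> (chance U V <= chance U' V')%R.
Proof.
move=> cU cV UU VV; rewrite -lee_fin -!chanceE; apply: le_measure; rewrite ?inE//.
by move=> y; exact: prec_mono.
Qed.

Lemma chance_add U V : (chance U V + chance V U <= 1)%R.
Proof.
rewrite -lee_fin EFinD -!chanceE -measureU//; last first.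
  by rewrite -subset0 => y [/prec_asym].
by apply: probability_le1; apply: measurableU.
Qed.

Lemma chance_total U V : ray_clopen U -> ray_clopen V -> U `&` V = set0 ->
  U `|` V !=set0 -> (1 <= chance U V + chance V U)%R.
Proof.
move=> cU cV UV0 UV.
rewrite -lee_fin EFinD -!chanceE -measureU//; last first.
  by rewrite -subset0 => y [/prec_asym].
rewrite -(@probability_setT _ _ _ mu); apply: le_measure; rewrite ?inE//.
  by apply: measurableU.
by move=> y _; have := prec_total (y : precedence d k) cU cV UV0 UV.
Qed.

Definition likely U V := (2^-1 < chance U V)%R.

Lemma likely_asym U V : likely U V -> likely V U -> False.
Proof. by rewrite /likely; have := chance_add U V; lra. Qed.

Lemma likely_mono U U' V V' : ray_clopen U' -> ray_clopen V' ->
  U `<=` U' -> V' `<=` V -> likely U V -> likely U' V'.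
Proof. by move=> cU cV UU VV /lt_le_trans; apply; exact: chance_mono. Qed.

Lemma chance_le3 (U1 U2 U3 V1 V2 V3 : set ray) :
  before U1 V1 `&` before U2 V2 = set0 ->
  before U1 V1 `&` before U3 V3 = set0 ->
  before U2 V2 `&` before U3 V3 = set0 ->
  (chance U1 V1 + chance U2 V2 + chance U3 V3 <= 1)%R.
Proof.
move=> d12 d13 d23; rewrite -lee_fin !EFinD -!chanceE -!measureU//.
- by apply: probability_le1; apply: measurableU => //; exact: measurableU.
- exact: measurableU.
- by rewrite setIUl d13 d23 setU0.
Qed.

(** At most one of the disjoint sets w i can be met before everything else in F, so
    one of these three events has chance at most 1/3. *)
Lemma likely_avoid (F : set ray) (w : 'I_3 -> set ray) : ray_clopen F ->
  (forall i, ray_clopen (w i)) -> (forall i, w i `<=` F) -> F !=set0 ->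
  (forall i j, i != j -> w i `&` w j = set0) ->
  exists i, likely (F `\` w i) (w i).
Proof.
move=> cF cw wF F0 w0.
have cD i : ray_clopen (F `\` w i).
  by apply: ray_clopenI => //; exact: ray_clopenC.
pose e i := chance (w i) (F `\` w i).
have disj i j : i != j ->
    before (w i) (F `\` w i) `&` before (w j) (F `\` w j) = set0.
  move=> ij; rewrite -subset0 => y [yi yj].
  have wD i' j' : i' != j' -> w j' `<=` F `\` w i'.
    move=> ij' x xj; split; first exact: wF xj.
    by move=> xi; have : (w i' `&` w j') x by []; rewrite w0.
  have := prec_mono (cw i) (cw j) (@subset_refl _ _) (wD i j ij) yi.
  apply: prec_asym.
  by apply: prec_mono yj => //; apply: wD; rewrite eq_sym.
pose t0 : 'I_3 := ord0; pose t1 : 'I_3 := @Ordinal 3 1 isT.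
pose t2 : 'I_3 := @Ordinal 3 2 isT.
have sum3 : (e t0 + e t1 + e t2 <= 1)%R by apply: chance_le3; exact: disj.
have [i ei] : exists i, (e i < 2^-1)%R.
  apply: contrapT => H.
  have ge i : (2^-1 <= e i)%R.
    by rewrite leNgt; apply/negP => ei; apply: H; exists i.
  by have := ge t0; have := ge t1; have := ge t2; move: sum3; lra.
exists i; rewrite /likely; have : (1 <= chance (F `\` w i) (w i) + e i)%R.
  apply: chance_total => //; first by rewrite setDKI.
  by move: F0 => [x Fx]; exists x; case: (pselect (w i x)); [right|left].
by move: ei; lra.
Qed.

End Likely.

Section Steer.
Variables (R : realType) (d k : nat) (i0 : 'I_k) (j0 j1 : 'I_d).
Hypothesis j01 : j0 != j1.
Local Notation neretin := (neretin d k).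
Local Notation ray := (ray d k).
Local Notation dense_ray := (dense_ray i0 j0).
Variable y0 : precedence d k.
Variable (mu : probability (borel (pointed_precedence y0)) R).
Local Notation likely := (likely mu).

(** At depth N, [block N i] is the ball around the i-th ray, and [rest N i] is what
    remains once the balls around the previous rays are removed. *)
Definition block N i : set ray := [set z | z N = dense_ray i N].

Definition rest N i : set ray := [set z | forall j, j < i -> ~ block N j z].

Lemma determined_block N i : determined N (block N i).
Proof. by move=> x y xy; rewrite /block/= xy. Qed.

Lemma determined_rest N i : determined N (rest N i).
Proof. by move=> x y xy xi j /xi H /(determined_block (esym xy)). Qed.

Lemma preimage_fixed (F : set ray) (g : neretin) (S : set ray) :
  (forall x, ~ F x -> act g x = x) -> S `&` F = set0 -> act g^-1 @^-1` S = S.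
Proof.
rewrite -subset0 => gF SF; apply/seteqP; split=> x /= Sx.
  have xF : ~ F (act g^-1 x) by move=> Fx; apply: (SF (act g^-1 x)).
  by rewrite -(actVK g x) gF.
have xF : ~ F x by move=> Fx; apply: (SF x).
by rewrite -(gF x xF) actK.
Qed.

Definition leads N (q : neretin) i :=
  likely (act q @^-1` block N i) (act q @^-1` rest N i.+1).

(** The correcting element g is supported in [rest N n], so it does not disturb what
    q achieves for the previous rays: their blocks are disjoint from that set, and
    the sets with which they are compared contain it. *)
Lemma steer_step N n (q : neretin) : rest N n (dense_ray n) ->
  exists g : neretin, leads N (g * q) n /\
    forall i, i < n -> leads N q i -> leads N (g * q) i.
Proof.
set F := rest N n => Fn.
have cB i : ray_clopen (block N i) by exists N; exact: determined_block.
have cF i : ray_clopen (rest N i) by exists N; exact: determined_rest.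
have [a na _] := ray_node (dense_ray n) N.
have aB : shadow (node a) `<=` block N n.
  move=> z; rewrite -na => /shadow_rayE zn.
  by rewrite /block/= -(ancestor_ray z (leqnSn N)) zn ancestor_ray.
have aF : shadow (node a) `<=` F.
  by move=> z /aB zB; apply: (determined_rest _ Fn).
(* The ball below a may have only two children, so one of them is split again. *)
pose v (i : 'I_3) := match val i with
  | 0 => kid a j1 | 1 => kid (kid a j0) j0 | _ => kid (kid a j0) j1 end.
have va i : shadow (node (v i)) `<=` shadow (node a).
  rewrite /v; case: (val i) => [|[|_]]; first exact: shadow_kid.
    by apply: (@subset_trans _ (shadow (node (kid a j0)))); exact: shadow_kid.
  by apply: (@subset_trans _ (shadow (node (kid a j0)))); exact: shadow_kid.
pose w i := act q @^-1` shadow (node (v i)).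
have [|||||i wi] := @likely_avoid R d k y0 mu (act q @^-1` F) w.
- exact/ray_clopen_act/cF.
- by move=> i; exact/ray_clopen_act/ray_clopen_shadow.
- by move=> i x /va/aF.
- by exists (act q^-1 (dense_ray n)); rewrite /= actVK.
- have k01 : shadow (node (kid a j1)) `&` shadow (node (kid a j0)) = set0.
    by apply: shadow_kids; rewrite eq_sym.
  have k2 := @shadow_kids d k (kid a j0) _ _ j01.
  have kk j : shadow (node (kid (kid a j0) j)) `<=` shadow (node (kid a j0)).
    exact: shadow_kid.
  have s0 (A B A' B' : set ray) : A `&` B = set0 ->
      A' `<=` A -> B' `<=` B -> A' `&` B' = set0.
    by move=> AB AA BB; rewrite -subset0 -AB; exact: setISS.
  move=> i i' ii'; rewrite /w -preimage_setI.
  suff -> : shadow (node (v i)) `&` shadow (node (v i')) = set0.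
    by rewrite preimage_set0.
  wlog lt_i : i i' ii' / i < i'.
    move=> H; case: (ltngtP i i') => [/H -> //||/val_inj ii]; last first.
      by rewrite ii eqxx in ii'.
    by rewrite setIC => /H; apply; rewrite eq_sym.
  move: ii' lt_i; case: i => -[|[|[|//]]] ?; case: i' => -[|[|[|//]]] ? //= _ _;
    exact: s0 k01 (@subset_refl _ _) (kk _).
have [g [gF ga]] := compress j01 (cF n) aF (va i).
exists g^-1.
have actgq S : act (g^-1 * q) @^-1` S = act q @^-1` (act g^-1 @^-1` S).
  by apply/seteqP; split=> x /=; rewrite actM.
have FE : act g^-1 @^-1` F = F.
  have := preimage_fixed gF (setICl F); rewrite -preimage_setC.
  by move=> /(congr1 setC); rewrite !setCK.
split=> [|m mn].
  rewrite /leads !actgq; apply: likely_mono wi.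
  - exact/ray_clopen_act/ray_clopen_act.
  - exact/ray_clopen_act/ray_clopen_act.
  - move=> x [/= Fx xv]; apply: aB; apply: contrapT => nxa; apply: xv.
    have gFx : F (act g^-1 (act q x)).
      by rewrite -[F _]/((act g^-1 @^-1` F) (act q x)) FE.
    by have := ga _ gFx nxa; rewrite actVK.
  - move=> x /= xf; have Fx : F (act g^-1 (act q x)).
      by move=> j jn; apply: xf; exact: ltnW.
    have nxa : ~ shadow (node a) (act g^-1 (act q x)).
      by move=> /aB; apply: xf.
    by have := ga _ Fx nxa; rewrite actVK.
rewrite /leads !actgq (@preimage_fixed F g (block N m))//; last first.
  by rewrite -subset0 => x [xm /(_ m mn)].
suff -> : act g^-1 @^-1` rest N m.+1 = rest N m.+1 by [].
have := @preimage_fixed F g (~` rest N m.+1) gF; rewrite -preimage_setC => H.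
rewrite -[RHS]setCK -H ?setCK// -subset0 => x [xm Fx]; apply: xm => j jm.
exact/Fx/(leq_trans jm).
Qed.

(** The hypothesis on i sets aside the rays that fall in the block of a previous
    one. *)
Lemma steer N n : exists q : neretin, forall i, i < n ->
  rest N i (dense_ray i) -> leads N q i.
Proof.
elim: n => [|n [q qP]]; first by exists 1.
have [Fn|nFn] := pselect (rest N n (dense_ray n)); last first.
  exists q => i; rewrite ltnS leq_eqVlt => /orP[/eqP ->|]; first by move/nFn.
  exact: qP.
have [g [gn gi]] := steer_step q Fn; exists (g * q) => i.
rewrite ltnS leq_eqVlt => /orP[/eqP -> //|ni] Fi; exact/gi/qP.
Qed.

Variable H : set neretin.
Hypothesis mu_inv : forall h, H h -> forall U V, ray_clopen U -> ray_clopen V ->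
  mu (before (act h @^-1` U) (act h @^-1` V)) = mu (before U V).

Lemma likely_inv h U V : H h -> ray_clopen U -> ray_clopen V ->
  likely U V -> likely (act h @^-1` U) (act h @^-1` V).
Proof. by move=> Hh cU cV; rewrite /likely /chance mu_inv. Qed.

(** Both V before c^-1 V and V before c V are likely; the invariance of mu under h
    turns one of them into the reverse of the other. *)
Lemma conj_not_displaces N (q c h : neretin) :
  (forall i, i < N -> rest N i (dense_ray i) -> leads N q i) ->
  H h -> c * q = q * h -> ~ displaces i0 j0 N c.
Proof.
move=> qP Hh cq [V [nV nP nP' [i iN [Vi Vlt Pi P'i]]]].
set P := act c @^-1` V in nP; set P' := act c^-1 @^-1` V in nP'.
have cV : ray_clopen V by exists N.
have cP : ray_clopen P by exists N.
have cP' : ray_clopen P' by exists N.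
have Fi : rest N i (dense_ray i).
  by move=> j ji ij; apply: (Vlt _ ji); exact: nV ij Vi.
have BV : block N i `<=` V by move=> z zi; exact: nV (esym zi) Vi.
have avoid S : determined N S -> (forall j, j <= i -> ~ S (dense_ray j)) ->
    S `<=` rest N i.+1.
  move=> nS iS z Sz j; rewrite ltnS => ji zj.
  by apply: (iS _ ji); exact: nS zj Sz.
have likelyq S : ray_clopen S -> S `<=` rest N i.+1 ->
    likely (act q @^-1` V) (act q @^-1` S).
  move=> cS SF; apply: likely_mono (qP _ iN Fi); try exact: ray_clopen_act.
    by move=> x; exact: BV.
  by move=> x; exact: SF.
have LP := likelyq _ cP (avoid _ nP Pi).
have LP' := likelyq _ cP' (avoid _ nP' P'i).
have hq S : act h @^-1` (act q @^-1` S) = act q @^-1` (act c @^-1` S).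
  by apply/seteqP; split=> x /=; rewrite -!actM cq.
have := likely_inv Hh (ray_clopen_act q cV) (ray_clopen_act q cP') LP'.
rewrite !hq; have -> : act c @^-1` P' = V.
  by apply/seteqP; split=> x; rewrite /P' /= actK.
exact: likely_asym LP.
Qed.

End Steer.

(** * Confined and cocompact subgroups *)

Section TopologicalGroups.
Variable G : topologicalGroupType.

Lemma cvg_mulg (T : Type) (F : set_system T) {FF : Filter F} (f f' : T -> G) a b :
  f @ F --> a -> f' @ F --> b -> (fun t => f t * f' t) @ F --> a * b.
Proof.
move=> fa fb; apply: (@cvg_comp _ _ _ (fun t => (f t, f' t))
  (fun p : G * G => p.1 * p.2) F (nbhs (a, b))); first exact: cvg_pair.
exact: (@mulg_continuous G (a, b)).
Qed.

Lemma cvg_invg (T : Type) (F : set_system T) {FF : Filter F} (f : T -> G) a :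
  f @ F --> a -> (fun t => (f t)^-1) @ F --> a^-1.
Proof.
move=> fa; apply: (@cvg_comp _ _ _ f (fun x : G => x^-1) F (nbhs a)) => //.
exact: (@invg_continuous G a).
Qed.

Lemma conjg_continuous (h : G) : continuous (fun x : G => x ^ h).
Proof.
move=> x; rewrite /conjg; apply: cvg_mulg; first exact: cvg_cst.
by apply: cvg_mulg; [exact: cvg_id|exact: cvg_cst].
Qed.

Lemma conj_by_continuous (h : G) : continuous (fun g : G => g * h * g^-1).
Proof.
move=> g; apply: cvg_mulg; last by apply: cvg_invg; exact: cvg_id.
by apply: cvg_mulg; [exact: cvg_id|exact: cvg_cst].
Qed.

Lemma conj_group_closed (H : closedSubgroup G) (g : G) :
  group_closed (mem [set x ^ g | x in (H : set G)]).
Proof.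
have [H1 HM] := closedSubgroup_group H; split.
  by rewrite inE; exists 1; [rewrite inE in H1|rewrite conj1g].
move=> _ _ /[!inE] -[x Hx <-] [y Hy <-]; exists (x / y).
  by have := HM x y; rewrite !inE; apply.
by rewrite conjMg conjVg.
Qed.

Lemma conj_closed (H : closedSubgroup G) (g : G) :
  closed [set x ^ g | x in (H : set G)].
Proof.
rewrite (_ : [set _ | _ in _] = (fun x => x ^ g^-1) @^-1` H).
  apply: preimage_closed; last exact: closedSubgroup_closed.
  by move=> x _; exact: conjg_continuous.
apply/seteqP; split=> [_ [x Hx <-]|x Hx] /=; first by rewrite conjgK.
by exists (x ^ g^-1) => //; rewrite conjgKV.
Qed.

Definition conj_subgroup (H : closedSubgroup G) (g : G) : closedSubgroup G :=
  ClosedSubgroup (conj_group_closed H g) (@conj_closed H g).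

(** The conditions of meeting a given open set that hold for the trivial subgroup
    hold for all subgroups, and finitely many conditions of avoiding a compact set
    amount to a single one. *)
Lemma nbhs_trivial_subgroup (U : set (closedSubgroup G)) :
  nbhs (trivial_subgroup G) U -> exists C : set G,
    [/\ compact C, ~ C 1 & forall K : closedSubgroup G, K `&` C = set0 -> U K].
Proof.
pose Phi : set_system (closedSubgroup G) := [set U | exists C : set G,
    [/\ compact C, ~ C 1 & forall K : closedSubgroup G, K `&` C = set0 -> U K]].
have FPhi : Filter Phi.
  split.
  - by exists set0; split=> //; exact: compact0.
  - move=> A B [C [cC C1 CA]] [D [cD D1 DB]]; exists (C `|` D); split.
    + exact: compactU.
    + by case.
    + move=> K; rewrite setIUr setU_eq0 => -[KC KD].
      by split; [exact: CA|exact: DB].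
  - by move=> A B AB [C [cC C1 CA]]; exists C; split=> // K /CA/AB.
suff cvPhi : Phi --> trivial_subgroup G by move/cvPhi.
have openE : @open (closedSubgroup G) = [set \bigcup_(A in E) A |
    E in subset^~ (finI_from (@chabauty_subbase G) id)] by [].
apply: (cvg_subbase openE) => A [[C cC <-]|[V oV <-]].
  move=> /= H; exists C; split=> // C1.
  by have : ([set 1] `&` C) (1 : G) by []; rewrite H.
move=> [_ [/= -> V1]]; exists set0; split=> //; first exact: compact0.
move=> K _; exists 1; split=> //.
by have [+ _] := closedSubgroup_group K; rewrite inE.
Qed.

(** A sequence accumulates in G / H, and neighbourhoods of g0 have open images in
    G / H. *)
Lemma cocompact_cluster (H : closedSubgroup G) (q : nat -> G) : cocompact H ->
  exists g0 : G, forall W : set G, nbhs g0 W -> forall N, exists n h,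
    [/\ N <= n, (H : set G) h & W (q n * h)].
Proof.
move=> cpt.
pose Q := quotient_topology {eq_quot lcoset_equiv H}.
pose p : G -> Q := fun g => (\pi_({eq_quot lcoset_equiv H}) g)%qT.
have pE x y : p x = p y <-> (H : set G) (x^-1 * y).
  split=> [/eqmodP|xy]; first by rewrite /= /lcoset_rel inE.
  by apply/eqmodP; rewrite /= /lcoset_rel inE.
have [|c [_ cl]] := cpt (p \o q @ \oo); first exact: filterT.
have [g0 g0c] : exists g0, p g0 = c by exists (repr c); exact: reprK.
exists g0 => W; rewrite nbhsE => -[V [oV Vg0] VW] N.
have oVH : open (p @` V).
  suff : open (p @^-1` (p @` V)) by [].
  rewrite openE => x [v Vv vx].
  have nx : \forall x' \near x, V (x' * (x^-1 * v)).
    have : (fun x' => x' * (x^-1 * v)) @ x --> x * (x^-1 * v).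
      by apply: cvg_mulg; [exact: cvg_id|exact: cvg_cst].
    by rewrite mulVKg; apply; exact: open_nbhs_nbhs.
  apply: filterS nx => x' Vx'; exists (x' * (x^-1 * v)) => //.
  by apply/esym/pE; rewrite mulKg; exact/pE/esym.
have Vc : nbhs c (p @` V).
  by apply: open_nbhs_nbhs; split=> //; exists g0.
have [|_ [[n Nn <-] [v Vv vq]]] :=
  cl [set p (q n) | n in [set n | N <= n]] _ _ Vc.
  by exists N => // n /= Nn; exists n.
exists n, ((q n)^-1 * v); split=> //; last by rewrite mulVKg; exact: VW.
exact/pE/esym.
Qed.

Lemma amenable_relatively (R : realType) (H : closedSubgroup G) :
  amenable R (subgroup_type H) -> relatively_amenable R H.
Proof.
move=> amH X hX cX actX [act1 actM actC].
have [|mu muP] := amH X hX cX (fun (s : subgroup_type H) x => actX (\val s) x).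
  split.
  - move=> x; have v1 : \val (1 : subgroup_type H) = 1.
      exact: (@val1 G _ (subgroup_type H)).
    by rewrite v1.
  - by move=> g h x; rewrite valM.
  - move=> [s x]; apply: (@continuous_comp _ _ _
      (fun z : subgroup_type H * X => (\val z.1, z.2))
      (fun p => actX p.1 p.2)); last exact: actC.
    apply: cvg_pair => /=; last exact: cvg_snd.
    by apply: cvg_comp; [exact: cvg_fst|exact: subgroup_val_continuous].
exists mu => h Hh B mB.
by have := muP (SigSub (mem_set Hh)) I B mB.
Qed.

End TopologicalGroups.

Section Neretin.
Variables (R : realType) (d k : nat) (i0 i1 : 'I_k) (j0 j1 : 'I_d).
Hypotheses (i01 : i0 != i1) (j01 : j0 != j1).
Local Notation neretin := (neretin d k).

Lemma amenable_not_displaces (H : set neretin) : relatively_amenable R H ->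
  exists q : nat -> neretin, forall N (c h : neretin),
    H h -> c * q N = q N * h -> ~ displaces i0 j0 N c.
Proof.
move=> amH; pose y0 := dense_precedence i0 j0.
have [|||mu muP] := amH (pointed_precedence y0) _ _ (@prec_act d k).
- exact: precedence_hausdorff.
- exact: precedence_compact.
- by split; [exact: prec_act1|exact: prec_actM|exact: prec_act_continuous].
have mu_inv h : H h -> forall U V, ray_clopen U -> ray_clopen V ->
    mu (before (act h @^-1` U) (act h @^-1` V)) = mu (before U V).
  move=> Hh U V cU cV; rewrite -(muP h Hh (before U V)); last first.
    exact: measurable_before.
  congr (mu _); apply/seteqP; split=> y; first by move/(prec_actE h y cU cV).2.
  by move/(prec_actE h y cU cV).1.
have /choice[q qP] := fun N => steer i0 j01 mu N N.
exists q => N c h Hh cq; exact: conj_not_displaces (qP N) Hh cq.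
Qed.

Lemma relatively_amenable_not_confined (H : closedSubgroup neretin) :
  relatively_amenable R H -> ~ confined H.
Proof.
move=> /amenable_not_displaces[q qP].
apply => U /nbhs_trivial_subgroup[C [cC C1 CU]].
have [N _ CN] : \forall N \near \oo, C `<=` displaces i0 j0 N.
  move/compact_near_coveringP: cC; apply=> c Cc; apply: (near_displaces i0 j01).
  by move=> c1; rewrite c1 in Cc.
exists (conj_subgroup H (q N)^-1); split; first by exists (q N)^-1.
apply: CU; rewrite -subset0 => _ [[h Hh <-]] /(CN N (leqnn N)).
by apply: qP Hh _; rewrite conjgE invgK -!mulgA mulVg mulg1.
Qed.

(** The exchanges of a fixed ball with the balls b n, which shrink to one ray, cannot
    accumulate at g0: the element g0 would send two distinct rays of the first ball
    to that ray. *)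
Lemma trivial_not_cocompact (H : closedSubgroup neretin) :
  H `<=` [set 1] -> ~ cocompact H.
Proof.
move=> H1 cH.
pose a : 'I_k * seq 'I_d := (i0, [::]).
pose b n : 'I_k * seq 'I_d := (i1, nseq n j0).
have ab n : shadow (node a) `&` shadow (node (b n)) = set0.
  rewrite -subset0 => x [xa xb]; case/eqP: i01.
  have := shadow_below xb (leqnn _); have := shadow_below xa (leq_addl n 1).
  rewrite /= size_nseq addn1; case: (x n.+1) => // -[i u] /= /andP[/eqP -> _].
  by case/andP => /eqP.
have /choice[s sP] := fun n => swap_shadows j0 (ab n).
have [g0 g0P] := cocompact_cluster s cH.
pose x j : ray d k := extend j0 (kid a j).
have xa j : shadow (node a) (x j) by apply: shadow_kid (extendP j0 (kid a j)).
have same : x j0 = x j1.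
  apply: (can_inj (actK g0)); apply: ray_eq => M.
  pose V j := shadow (act g0 (x j) M).
  have cV j : ray_clopen (V j) by exact: ray_clopen_shadow.
  have near_V := filterI (near_act g0 (cV j0)) (near_act g0 (cV j1)).
  have [n [h [Mn /H1 -> ]]] := g0P _ (near_V _) M.
  rewrite mulg1 => -[n0 n1].
  have sV j : act (s n) @^-1` V j = act g0 @^-1` V j ->
      act g0 (x j) M = act (s n) (x j) M.
    move=> E; have : (act g0 @^-1` V j) (x j) by rewrite /V /=; exact: shadow_ray.
    by rewrite -E => /shadow_rayE.
  rewrite (sV _ n0) (sV _ n1).
  have on j := (sP n).1 _ (xa j).
  by rewrite !(on_rayE (on _)) //= size_nseq ltnW.
have := extendP j0 (kid a j0); rewrite -/(x j0) same => sh0.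
have sh1 := extendP j0 (kid a j1).
have := @shadow_depth d k (node (kid a j0)) (node (kid a j1)) _ erefl sh0 sh1.
by move=> [] /eqP; apply/negP.
Qed.

(** With g0 an accumulation point of the steering elements modulo H and h <> 1 in H,
    the conjugates of h by elements near g0 are all displaced at a common scale; but
    among them there are elements of the conjugates of H by steering elements of
    finer scales. *)
Lemma cocompact_not_amenable (H : closedSubgroup neretin) :
  cocompact H -> ~ relatively_amenable R H.
Proof.
move=> cH /amenable_not_displaces[q qP].
have [h Hh h1] : exists2 h, (H : set neretin) h & h <> 1.
  apply: contrapT => nH; apply: trivial_not_cocompact cH => h Hh /=.
  by apply: contrapT => h1; apply: nH; exists h.
have [g0 g0P] := cocompact_cluster q cH.
pose f (g : neretin) := g * h * g^-1.
have c1 : f g0 <> 1.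
  move=> E; apply: h1; apply: (mulgI g0); apply: (mulIg g0^-1).
  by rewrite -/(f g0) E mulg1 mulgV.
have [[B N0] /= [Bc [N _ NP]] displaces_B] := near_displaces i0 j01 c1.
have nW : nbhs g0 (f @^-1` B).
  exact: (@conj_by_continuous _ h g0 _ Bc).
have [n [e [Nn He /= Bf]]] := g0P _ nW N.
apply: (qP n (f (q n * e)) (e * h * e^-1)).
- have HM := group_closedM (closedSubgroup_group H).
  have HV := group_closedV (closedSubgroup_group H).
  have := HM _ _ (HM _ _ (mem_set He) (mem_set Hh)) (HV _ (mem_set He)).
  by rewrite inE.
- by rewrite /f invgM !mulgA mulgVK.
- exact: (displaces_B (f (q n * e), n) (conj Bf (NP n Nn))).
Qed.

End Neretin.

Theorem corollary1p4 (R : realType) (d k : nat)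
    (hd : (2 <= d)%N) (hk : (2 <= k)%N) :
  (~ exists H : closedSubgroup (neretin d k),
       confined H /\ relatively_amenable R H) /\
  (~ exists H : closedSubgroup (neretin d k),
       cocompact H /\ amenable R (subgroup_type H)).
Proof.
pose i0 : 'I_k := Ordinal (ltnW hk); pose i1 : 'I_k := Ordinal hk.
pose j0 : 'I_d := Ordinal (ltnW hd); pose j1 : 'I_d := Ordinal hd.
have i01 : i0 != i1 by []; have j01 : j0 != j1 by [].
split=> -[H].
  by move=> [cH aH]; exact: relatively_amenable_not_confined j01 _ aH cH.
by move=> [cH /amenable_relatively]; exact: cocompact_not_amenable i01 j01 _ cH.
Qed.
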